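(* Let $\alpha\in\mathbb R\setminus\{0,1\}$. Suppose either $\lambda=\alpha$ with $\alpha\notin\mathbb N$, or $\lambda=1$ with $\alpha^{-1}\notin\mathbb N$. Define the superfunction $\mathbb I_\lambda(z,w)$ by $$\mathbb I_\alpha(z,w)=\Gamma(-\alpha)\,\widetilde I_{-1-\alpha}\!\left(2\sqrt{(z|\overline w)}\right),\qquad \mathbb I_1(z,w)=\Gamma(-\alpha^{-1})\,\widetilde I_{-1-\alpha^{-1}}\!\left(2\sqrt{\alpha^{-1}(z|\overline w)}\right).$$ Then for all $p\in\mathcal F_\lambda$ $$\langle p(z),\mathbb I_\lambda(z,w)\rangle_{\mathcal B}=p(w),$$ where the Bessel–Fischer product is taken in the variable $z$ and the equality holds modulo $\mathcal I_\lambda$ in the variable $w$.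
   Context: $\mathbb N=\{0,1,2,\dots\}$. $\mathcal P(\mathbb C^{2|2})=\mathbb C[z_1,z_2]\otimes\Lambda(z_3,z_4)$, with $z_1,z_2$ even and $z_3,z_4$ odd; $\partial_i=\partial_{z_i}$ are the (left) partial superderivatives. The Bessel operators are $\mathcal B_\lambda(z_1)=(-\lambda+z_1\partial_1+z_3\partial_3+z_4\partial_4)\partial_1-2\alpha z_2\partial_3\partial_4$, $\mathcal B_\lambda(z_2)=(-\tfrac{\lambda}{\alpha}+z_2\partial_2+z_3\partial_3+z_4\partial_4)\partial_2-2z_1\partial_3\partial_4$, $\mathcal B_\lambda(z_3)=(-2\lambda+2z_1\partial_1+2\alpha z_2\partial_2+2(1+\alpha)z_3\partial_3)\partial_4+z_3\partial_1\partial_2$, $\mathcal B_\lambda(z_4)=(2\lambda-2z_1\partial_1-2\alpha z_2\partial_2-2(1+\alpha)z_4\partial_4)\partial_3+z_4\partial_1\partial_2$. They supercommute. $\mathcal I_\lambda$ is the ideal of $\mathcal P(\mathbb C^{2|2})$ generated by $2z_1z_2+z_3z_4,\ z_2^2,\ z_2z_3,\ z_2z_4$ if $\lambda=\alpha$, and by $2\alpha z_1z_2+z_3z_4,\ z_1^2,\ z_1z_3,\ z_1z_4$ if $\lambda=1$. $\mathcal F_\lambda=\mathcal P(\mathbb C^{2|2})/\mathcal I_\lambda$. The Bessel–Fischer product is $\langle p,q\rangle_{\mathcal B}=p(\mathcal B_\lambda)\,\bar q(z)|_{z=0}$, where $p(\mathcal B_\lambda)$ is obtained by replacing each monomial $z_1^{\gamma_1}z_2^{\gamma_2}z_3^{\gamma_3}z_4^{\gamma_4}$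 of $p$ by $\mathcal B_\lambda(z_1)^{\gamma_1}\mathcal B_\lambda(z_2)^{\gamma_2}\mathcal B_\lambda(z_3)^{\gamma_3}\mathcal B_\lambda(z_4)^{\gamma_4}$ and $\bar q$ is obtained by conjugating the coefficients of $q$; it descends to $\mathcal F_\lambda$. Let $w=(w_1,w_2,w_3,w_4)$ be a second set of coordinates ($w_1,w_2$ even, $w_3,w_4$ odd, the odd $z$'s and $w$'s anticommuting). Put $z|w=z_1w_1+\alpha z_2w_2-\tfrac12 z_3w_4+\tfrac12 z_4w_3$. In $\langle p(z),q(z,\overline w)\rangle_{\mathcal B}$ the conjugation turns $\overline w$ into $w$, e.g. $\langle p(z),(z|\overline w)^k\rangle_{\mathcal B}=p(\mathcal B_\lambda)(z|w)^k|_{z=0}$. $\widetilde I_\gamma(t)=(t/2)^{-\gamma}I_\gamma(t)=\sum_{k\ge0}\frac{1}{k!\,\Gamma(k+\gamma+1)}(t/2)^{2k}$ is the renormalised modified Bessel function of the first kind; thus $\mathbb I_\lambda(z,w)$ is a power series in $(z|\overline w)$, and the product with a polynomial $p$ is computed degree by degree (homogeneous elements of different degrees are orthogonal, so only finitely many terms contribute). *)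

(* Defs.v *)
From HB Require Import structures.
From mathcomp Require Import all_boot all_order all_algebra.
From mathcomp Require Import boolp reals.
From mathcomp Require topology normedtype sequences exp.
From mathcomp Require Import complex.

Set Implicit Arguments.
Unset Strict Implicit.
Unset Printing Implicit Defensive.

Import Order.TTheory GRing.Theory Num.Theory.
Local Open Scope ring_scope.

(* The analysis notations clash with those of mpoly, so they are only
   imported inside this module. *)
Module EulerGamma.
Import classical_sets topology normedtype sequences exp.
Import numFieldNormedType.Exports.

(* Euler's limit formula: unlike the integral, it also covers the negative
   non-integers, which are needed below.  At a pole s = 0, -1, -2, ... the
   product eventually vanishes, so that Gamma s = 0 and 1 / Gamma s = 0. *)
Definition Gamma (R : realType) (s : R) : R :=
  limn (fun n : nat =>
    n`!%:R * (n%:R `^ s) / \prod_(j < n.+1) (s + j%:R) : R^o).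

End EulerGamma.

Notation Gamma := EulerGamma.Gamma.

From mathcomp Require Import mpoly.

(* K[x_1, ..., x_m] (x) Lambda(theta_1, ..., theta_n): the value of f at a set
   S = {j_1 < ... < j_r} is the coefficient of theta_{j_1} ... theta_{j_r}. *)
Definition superpoly (K : comNzRingType) (m n : nat) :=
  {ffun {set 'I_n} -> {mpoly K[m]}}.

HB.instance Definition _ (K : comNzRingType) m n :=
  GRing.Lmodule.copy (superpoly K m n) {ffun {set 'I_n} -> {mpoly K[m]}}.

(* theta_A theta_B = (-1)^(inversions A B) theta_(A u B) for A, B disjoint. *)
Definition inversions n (A B : {set 'I_n}) : nat :=
  \sum_(a in A) \sum_(b in B) (b < a)%N.

Section SuperpolyRing.
Variables (K : comNzRingType) (m n : nat).
Local Notation P := (superpoly K m n).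
Implicit Types (f g h : P) (A B S : {set 'I_n}).

Definition sp_one : P := [ffun S => (S == finset.set0)%:R].

Definition sp_mul f g : P :=
  [ffun S : {set 'I_n} => \sum_(A in powerset S)
     (-1) ^+ inversions A (S :\: A) * f A * g (S :\: A)].

Let sp_k A B S : {mpoly K[m]} :=
  if [disjoint A & B] && (A :|: B == S) then (-1) ^+ inversions A B else 0.

Let sp_mulE f g S : sp_mul f g S = \sum_A \sum_B sp_k A B S * f A * g B.
Proof.
rewrite ffunE big_mkcond; apply: eq_bigr => A _; rewrite powersetE.
case: ifPn => sAS; last first.
  rewrite big1 // => B _; rewrite /sp_k.
  case: ifP => [/andP[_ /eqP eqS]|_]; last by rewrite !mul0r.
  by case/negP: sAS; rewrite -eqS subsetUl.
rewrite (bigD1 (S :\: A)) //= big1 ?addr0 => [|B neB]; rewrite /sp_k.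
  have /setIidPl SA := sAS.
  rewrite -setI_eq0 setIDA SA setDv eqxx /=.
  by rewrite -[X in X :|: _ == _]SA setIC setID eqxx.
case: ifP => [/andP[dAB /eqP eqS]|_]; last by rewrite !mul0r.
case/eqP: neB; rewrite -eqS setDUl setDv set0U.
by apply/esym/setDidPl; rewrite disjoint_sym.
Qed.

Let big_disjU A B (F : 'I_n -> nat) : [disjoint A & B] ->
  (\sum_(i in A :|: B) F i = \sum_(i in A) F i + \sum_(i in B) F i)%N.
Proof. by move=> dAB; rewrite -bigU //; apply: eq_bigl => i; rewrite !inE. Qed.

Let sp_k_split A B C S :
  \sum_D sp_k A D S * sp_k B C D = \sum_D sp_k A B D * sp_k D C S.
Proof.
rewrite (bigD1 (B :|: C)) //= big1 ?addr0; last first.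
  move=> D /negPf neD; rewrite /sp_k [_ == D]eq_sym neD andbF mulr0 //.
rewrite (bigD1 (A :|: B)) //= big1 ?addr0; last first.
  move=> D /negPf neD; rewrite /sp_k [_ == D]eq_sym neD andbF mul0r //.
rewrite /sp_k !eqxx !andbT -!setI_eq0 setIUr setIUl !setU_eq0 !setI_eq0 setUA.
have inv_l : [disjoint A & B] ->
    inversions (A :|: B) C = (inversions A C + inversions B C)%N.
  by move=> dAB; rewrite /inversions big_disjU.
have inv_r : [disjoint B & C] ->
    inversions A (B :|: C) = (inversions A B + inversions A C)%N.
  move=> dBC; rewrite /inversions -big_split; apply: eq_bigr => a _ /=.
  by rewrite big_disjU.
case dAB: [disjoint A & B]; case dBC: [disjoint B & C];
  case dAC: [disjoint A & C]; rewrite /= ?mulr0 ?mul0r //.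
case: ifP => _; rewrite ?mul0r ?mulr0 // inv_l // inv_r // -!exprD.
by rewrite addnA.
Qed.

Let sp_mulA : associative sp_mul.
Proof.
move=> f g h; apply/ffunP => S; rewrite !sp_mulE.
transitivity (\sum_A \sum_B \sum_C
    (\sum_D sp_k A D S * sp_k B C D) * (f A * g B * h C)).
  apply: eq_bigr => A _.
  under eq_bigr => D _.
    rewrite sp_mulE mulr_sumr; under eq_bigr => B _ do rewrite mulr_sumr.
    over.
  rewrite exchange_big /=; apply: eq_bigr => B _.
  rewrite exchange_big /=; apply: eq_bigr => C _.
  rewrite mulr_suml; apply: eq_bigr => D _.
  by rewrite -!mulrA; congr (_ * _); rewrite mulrCA; congr (_ * _); rewrite mulrCA.
transitivity (\sum_C \sum_D \sum_A \sum_B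
    (sp_k A B D * sp_k D C S) * (f A * g B * h C)); last first.
  rewrite exchange_big /=; apply: eq_bigr => D _; apply: eq_bigr => C _.
  rewrite sp_mulE mulr_sumr mulr_suml; apply: eq_bigr => A _.
  rewrite mulr_sumr mulr_suml; apply: eq_bigr => B _.
  by rewrite -!mulrA mulrCA.
symmetry; under eq_bigr => C _.
  rewrite exchange_big /=; under eq_bigr => A _ do rewrite exchange_big /=.
  over.
rewrite exchange_big /=; apply: eq_bigr => A _.
rewrite exchange_big /=; apply: eq_bigr => B _; apply: eq_bigr => C _.
by rewrite sp_k_split mulr_suml.
Qed.

Let inv0l A : inversions finset.set0 A = 0%N.
Proof. by rewrite /inversions big_set0. Qed.

Let inv0r A : inversions A finset.set0 = 0%N.
Proof. by rewrite /inversions big1 // => a _; rewrite big_set0. Qed.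

Let sp_mul1l : left_id sp_one sp_mul.
Proof.
move=> f; apply/ffunP => S; rewrite ffunE (bigD1 finset.set0) /=; last first.
  by rewrite powersetE sub0set.
rewrite big1 ?addr0 => [|A /andP[_ /negPf nA]].
  by rewrite ffunE eqxx setD0 inv0l !mul1r.
by rewrite ffunE nA mulr0 mul0r.
Qed.

Let sp_mul1r : right_id sp_one sp_mul.
Proof.
move=> f; apply/ffunP => S; rewrite ffunE (bigD1 S) /=; last first.
  by rewrite powersetE.
rewrite big1 ?addr0 => [|A /andP[]].
  by rewrite setDv ffunE eqxx inv0r mul1r mulr1.
rewrite powersetE => sAS nA; rewrite ffunE setD_eq0.
case: (boolP (S \subset A)) => [sSA|_]; last by rewrite mulr0.
by case/negP: nA; rewrite eqEsubset sAS.
Qed.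

Let sp_mulDl : left_distributive sp_mul +%R.
Proof.
move=> f g h; apply/ffunP => S; rewrite !ffunE -big_split.
by apply: eq_bigr => A _; rewrite ffunE mulrDr mulrDl.
Qed.

Let sp_mulDr : right_distributive sp_mul +%R.
Proof.
move=> f g h; apply/ffunP => S; rewrite !ffunE -big_split.
by apply: eq_bigr => A _; rewrite ffunE mulrDr.
Qed.

Let sp_one_neq0 : sp_one != 0.
Proof.
apply/eqP => /ffunP /(_ finset.set0); rewrite !ffunE eqxx.
by apply/eqP; rewrite oner_neq0.
Qed.

HB.instance Definition _ := GRing.Zmodule_isNzRing.Build P
  sp_mulA sp_mul1l sp_mul1r sp_mulDl sp_mulDr sp_one_neq0.

Fact sp_scaleAl (a : K) f g : a *: (f * g) = (a *: f) * g.
Proof.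
apply/ffunP => S; rewrite /GRing.mul /= !ffunE scaler_sumr.
by apply: eq_bigr => A _; rewrite ffunE -scalerAr scalerAl.
Qed.

HB.instance Definition _ := GRing.Lmodule_isLalgebra.Build K P sp_scaleAl.

Definition sp_even (i : 'I_m) : P :=
  [ffun S => if S == finset.set0 then 'X_i else 0].

Definition sp_odd (j : 'I_n) : P := [ffun S => (S == [set j])%:R].

Definition d_even (i : 'I_m) f : P := [ffun S : {set 'I_n} => (f S)^`M(i)].

(* Left derivative: theta_j theta_S = (-1)^#{k in S | k < j} theta_(j |: S)
   for j \notin S. *)
Definition d_odd (j : 'I_n) f : P := [ffun S : {set 'I_n} =>
  if j \in S then 0 else (-1) ^+ #|[set k in S | (k < j)%N]| * f (j |: S)].

Definition sp_map (phi : K -> K) f : P :=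
  [ffun S : {set 'I_n} => map_mpoly phi (f S)].

End SuperpolyRing.

Inductive ideal_gen (A : nzRingType) (G : seq A) : A -> Prop :=
| ideal_gen_mem g of g \in G : ideal_gen G g
| ideal_gen0 : ideal_gen G 0
| ideal_genD x y of ideal_gen G x & ideal_gen G y : ideal_gen G (x + y)
| ideal_genMl a x of ideal_gen G x : ideal_gen G (a * x)
| ideal_genMr a x of ideal_gen G x : ideal_gen G (x * a).

Definition ideal_pred (A : nzRingType) (G : seq A) : {pred A} :=
  fun x => `[< ideal_gen G x >].

Fact ideal_pred_zmod (A : nzRingType) (G : seq A) : zmod_closed (ideal_pred G).
Proof.
split=> [|x y /asboolP Gx /asboolP Gy]; apply/asboolP; first exact: ideal_gen0.
by apply: ideal_genD => //; rewrite -mulN1r; apply: ideal_genMl.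
Qed.

HB.instance Definition _ (A : nzRingType) (G : seq A) :=
  GRing.isZmodClosed.Build A (ideal_pred G) (ideal_pred_zmod G).

Section BesselFischer.
Variables (R : realType) (alpha lambda : R).
Local Notation C := (complex R).
Local Notation "x %:C" := (real_complex R x).

(* P(C^{2|2}), the variables z_1, z_2, z_3, z_4 being the even variables
   0, 1 and the odd variables 0, 1. *)
Definition P22 := superpoly C 2 2.

(* Polynomials in z and w: the z's come first, so that the even (odd) variables
   lshift 2 i are z_1, z_2 (z_3, z_4) and the rshift 2 i are w_1, w_2
   (w_3, w_4); all odd variables anticommute. *)
Definition Pzw := superpoly C (2 + 2) (2 + 2).

Let i1 : 'I_2 := ord0.
Let i2 : 'I_2 := ord_max.

Definition z1 : Pzw := sp_even C _ (lshift 2 i1).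
Definition z2 : Pzw := sp_even C _ (lshift 2 i2).
Definition z3 : Pzw := sp_odd C _ (lshift 2 i1).
Definition z4 : Pzw := sp_odd C _ (lshift 2 i2).
Definition w1 : Pzw := sp_even C _ (rshift 2 i1).
Definition w2 : Pzw := sp_even C _ (rshift 2 i2).
Definition w3 : Pzw := sp_odd C _ (rshift 2 i1).
Definition w4 : Pzw := sp_odd C _ (rshift 2 i2).
Definition d1 : Pzw -> Pzw := d_even (lshift 2 i1).
Definition d2 : Pzw -> Pzw := d_even (lshift 2 i2).
Definition d3 : Pzw -> Pzw := d_odd (lshift 2 i1).
Definition d4 : Pzw -> Pzw := d_odd (lshift 2 i2).

Definition bessel1 (q : Pzw) : Pzw := let q1 := d1 q in
  - lambda%:C *: q1 + z1 * d1 q1 + z3 * d3 q1 + z4 * d4 q1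
  - (2 * alpha)%:C *: (z2 * d3 (d4 q)).

Definition bessel2 (q : Pzw) : Pzw := let q2 := d2 q in
  - (lambda / alpha)%:C *: q2 + z2 * d2 q2 + z3 * d3 q2 + z4 * d4 q2
  - 2 *: (z1 * d3 (d4 q)).

Definition bessel3 (q : Pzw) : Pzw := let q4 := d4 q in
  - (2 * lambda)%:C *: q4 + 2 *: (z1 * d1 q4) + (2 * alpha)%:C *: (z2 * d2 q4)
  + (2 * (1 + alpha))%:C *: (z3 * d3 q4) + z3 * d1 (d2 q).

Definition bessel4 (q : Pzw) : Pzw := let q3 := d3 q in
  (2 * lambda)%:C *: q3 - 2 *: (z1 * d1 q3) - (2 * alpha)%:C *: (z2 * d2 q3)
  - (2 * (1 + alpha))%:C *: (z4 * d4 q3) + z4 * d1 (d2 q).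

(* p(B_lambda) q; the odd exponents gamma_3, gamma_4 are the
   booleans i1 \in S, i2 \in S. *)
Definition bessel_subst (p : P22) (q : Pzw) : Pzw :=
  \sum_(S : {set 'I_2}) \sum_(g <- msupp (p S)) (p S)@_g *:
    iter (g i1) bessel1 (iter (g i2) bessel2
      (iter (i1 \in S) bessel3 (iter (i2 \in S) bessel4 q))).

Definition at_z0 (q : Pzw) : P22 := [ffun S : {set 'I_2} =>
  q [set rshift 2 j | j in S] \mPo
    [tuple (if split i is inr j then 'X_j else 0) | i < 2 + 2]].

(* <p(z), q(z, \bar w)>_B.  The second argument is a polynomial in z and
   \bar w; after conjugation, which only affects the coefficients here, its
   second set of variables is read as w. *)
Definition bessel_fischer (p : P22) (q : Pzw) : P22 :=
  at_z0 (bessel_subst p (sp_map (@Num.conj C) q)).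

(* <p, \sum_k q_k>_B = r for a formal series all but finitely many terms of
   which pair to zero with p. *)
Definition bessel_fischer_series (p : P22) (q : nat -> Pzw) (r : P22) : Prop :=
  exists N, forall n, (N <= n)%N -> \sum_(k < n) bessel_fischer p (q k) = r.

Definition ideal_gens : seq P22 :=
  let x1 : P22 := sp_even C _ i1 in let x2 : P22 := sp_even C _ i2 in
  let x3 : P22 := sp_odd C _ i1 in let x4 : P22 := sp_odd C _ i2 in
  if lambda == alpha then
    [:: 2 *: (x1 * x2) + x3 * x4; x2 ^+ 2; x2 * x3; x2 * x4]
  else if lambda == 1 then
    [:: (2 * alpha)%:C *: (x1 * x2) + x3 * x4; x1 ^+ 2; x1 * x3; x1 * x4]
  else [::].

Definition fock := {ideal_quot ideal_pred ideal_gens}.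

Definition zw_pairing : Pzw :=
  z1 * w1 + alpha%:C *: (z2 * w2) - 2^-1 *: (z3 * w4) + 2^-1 *: (z4 * w3).

(* The k-th term of \tilde I_gamma(2 sqrt x), where (t / 2)^(2 k) = x^k. *)
Definition bessel_I (gamma : R) (x : Pzw) (k : nat) : Pzw :=
  ((k`!%:R * Gamma (k%:R + gamma + 1))^-1)%:C *: x ^+ k.

Definition repr_kernel (k : nat) : Pzw :=
  if lambda == alpha then
    (Gamma (- alpha))%:C *: bessel_I (- 1 - alpha) zw_pairing k
  else
    (Gamma (- alpha^-1))%:C *:
      bessel_I (- 1 - alpha^-1) ((alpha^-1)%:C *: zw_pairing) k.

End BesselFischer.

(* Main.v *)
Require Import Defs.
From HB Require Import structures.
From mathcomp Require Import all_boot all_order all_algebra ring lra.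
From mathcomp Require Import boolp reals complex.
From mathcomp Require classical_sets topology normedtype sequences exp.

(** Write x for the pairing z|w.  The theorem holds because, up to a scalar, the
    Bessel operators act on the powers of x as first-order derivatives would: in
    the case lambda = alpha,
      B(z_i) x^k = k (k - 1 - alpha) w_i x^(k-1)   for i = 1, 2, 3, 4,
    modulo the relations of the Fock space read in the variables w (lemmas
    [gbessel1_exp] to [gbessel4_exp]).  The Bessel operators only involve z, so
    they commute up to sign with multiplication by the w_i and preserve those
    relations.  Hence a monomial p of degree n turns x^k into a scalar times
    p(w) x^(k-n) ([bessel_word_exp]).  At z = 0 only k = n survives: for k < n
    the scalar contains the factor attached to k = 0, and for k > n the power
    x^(k-n) vanishes.  The scalar left at k = n is n! (-alpha)(1-alpha)...
    (n-1-alpha), which the coefficient Gamma(-alpha) / (n! Gamma(n-alpha)) of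
    the kernel inverts by the functional equation of Gamma ([Gamma_ratio]).

    The two cases are one computation.  With parameters (a, b), pairing
    x = a z_1 w_1 + b z_2 w_2 - z_3 w_4 / 2 + z_4 w_3 / 2 and relations
    2 a w_1 w_2 + w_3 w_4, w_2^2, w_2 w_3, w_2 w_4, the scalar is
    k (a (k - 1) - b).  The case lambda = alpha is (a, b) = (1, alpha); the case
    lambda = 1 is (a, b) = (alpha, 1) after exchanging the indices 1 and 2, and
    there the powers of alpha^-1 in the kernel absorb the factor a.

    The sum over k must be eventually constant exactly, and not only modulo the
    relations.  This follows from a degree argument in z: a product of n Bessel
    operators lowers the order of vanishing at z = 0 by at most n
    ([zfilt_bessel_word]).

    Finally Gamma is given by the limit of Euler's products at negative
    arguments too, so that its convergence to a nonzero value has to be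
    established.  On (0, 1] Bernoulli's inequality makes the products increasing
    and bounded, and the functional equation carries this to every argument
    outside the poles ([euler_cvg]). *)

Set Implicit Arguments.
Unset Strict Implicit.
Unset Printing Implicit Defensive.

Import Order.TTheory GRing.Theory Num.Theory.
Local Open Scope ring_scope.

(** * Convergence of Euler's product for Gamma *)

Module GammaLimit.
Import classical_sets topology normedtype sequences exp.
Import numFieldNormedType.Exports.
Local Open Scope classical_set_scope.

Section GammaLimit.
Variable R : realType.
Implicit Types s t x : R.

(** The products are shifted by one, so that the base n.+1 of the real power is
    never 0. *)
Definition euler_seq s (n : nat) : R^o :=
  n.+1`!%:R * (n.+1%:R `^ s) / \prod_(j < n.+2) (s + j%:R).

Definition nonpole s := forall j : nat, s + j%:R != 0.

Lemma nonpoleD s n : nonpole s -> nonpole (s + n%:R).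
Proof. by move=> s0 j; rewrite -addrA -natrD; apply: s0. Qed.

Lemma gt0_nonpole s : 0 < s -> nonpole s.
Proof. by move=> s0 j; rewrite gt_eqF // ltr_wpDr. Qed.

Lemma Gamma_lim s L : euler_seq s @ \oo --> (L : R^o) -> Gamma s = L.
Proof.
move=> uL; rewrite /Gamma; apply: cvg_lim => //.
by rewrite -(cvg_shiftS (fun n : nat => n`!%:R * (n%:R `^ s) /
  \prod_(j < n.+1) (s + j%:R) : R^o)).
Qed.

Lemma prod_neq0 s n : nonpole s -> \prod_(j < n) (s + j%:R) != 0.
Proof. by move=> s0; apply/prodf_neq0 => j _; apply: s0. Qed.

(** The products at s and s + 1 differ by a factor that tends to s^-1: this is
    where the functional equation comes from, and it moves convergence both
    up and down by 1. *)
Lemma euler_seq_shift s n : nonpole s ->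
  euler_seq s n = euler_seq (s + 1) n * (s^-1 * (1 + (s + 1) * n.+1%:R^-1)).
Proof.
move=> s0; rewrite /euler_seq.
have s00 : s != 0 by have := s0 0%N; rewrite addr0.
have n0 : n.+1%:R != 0 :> R by rewrite pnatr_eq0.
have p1 := prod_neq0 n.+2 s0; have p2 := prod_neq0 n.+2 (nonpoleD 1 s0).
have sn := s0 n.+2.
have eqp : \prod_(j < n.+2) (s + 1 + j%:R) * s =
    \prod_(j < n.+2) (s + j%:R) * (s + n.+2%:R).
  transitivity (\prod_(j < n.+3) (s + j%:R)); last by rewrite big_ord_recr.
  rewrite [RHS]big_ord_recl /= addr0 mulrC; congr (_ * _).
  by apply: eq_bigr => j _; rewrite /bump /= natrD addrA.
have -> : \prod_(j < n.+2) (s + 1 + j%:R) =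
    \prod_(j < n.+2) (s + j%:R) * (s + n.+2%:R) / s.
  by rewrite -eqp mulfK.
rewrite powRD ?n0 ?implybT // powRr1 //.
have e : n.+2%:R = n.+1%:R + 1 :> R by rewrite -natr1.
have -> : s + 1 = s + n.+2%:R - n.+1%:R by rewrite e; ring.
field.
by rewrite nat1r -natrD n0 s00 sn p1.
Qed.

Lemma shift_factor_cvg s :
  (fun n => s^-1 * (1 + (s + 1) * n.+1%:R^-1) : R^o) @ \oo --> (s^-1 : R^o).
Proof.
rewrite -[X in _ --> X]mulr1; apply: cvgM; first exact: cvg_cst.
rewrite -[X in _ --> X]addr0; apply: cvgD; first exact: cvg_cst.
rewrite -[X in _ --> X](mulr0 (s + 1)); apply: cvgM; first exact: cvg_cst.
exact: cvg_harmonic.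
Qed.

Lemma euler_cvg_down s L : nonpole s -> euler_seq (s + 1) @ \oo --> (L : R^o) ->
  euler_seq s @ \oo --> (L / s : R^o).
Proof.
move=> s0 uL; rewrite (_ : euler_seq s = fun n =>
  euler_seq (s + 1) n * (s^-1 * (1 + (s + 1) * n.+1%:R^-1))).
  by apply: cvgM => //; apply: shift_factor_cvg.
by apply/boolp.funext => n; rewrite euler_seq_shift.
Qed.

Lemma euler_cvg_up s L : nonpole s -> euler_seq s @ \oo --> (L : R^o) ->
  euler_seq (s + 1) @ \oo --> (s * L : R^o).
Proof.
move=> s0 uL.
have s00 : s != 0 by have := s0 0%N; rewrite addr0.
have n0 n : n.+1%:R != 0 :> R by rewrite pnatr_eq0.
have f0 n : s^-1 * (1 + (s + 1) * n.+1%:R^-1) != 0.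
  rewrite mulf_neq0 ?invr_neq0 //.
  have := s0 n.+2; apply: contraNneq => e.
  have -> : s + n.+2%:R = n.+1%:R * (1 + (s + 1) * n.+1%:R^-1).
    by rewrite -[n.+2%:R]natr1; field; rewrite nat1r.
  by rewrite e mulr0.
rewrite (_ : euler_seq (s + 1) = fun n =>
  (s^-1 * (1 + (s + 1) * n.+1%:R^-1))^-1 * euler_seq s n).
  apply: cvgM => //; rewrite -[X in _ --> X]invrK; apply: cvgV.
    by rewrite invr_eq0.
  exact: shift_factor_cvg.
by apply/boolp.funext => n; rewrite (euler_seq_shift n s0) mulrC mulfK.
Qed.

(** Young's inequality for a^s and 1, with conjugate exponents 1/s and
    1/(1-s). *)
Lemma bernoulli_powR a s : 0 <= a -> 0 < s <= 1 -> a `^ s <= 1 + s * (a - 1).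
Proof.
move=> a0 /andP[s0]; rewrite le_eqVlt => /predU1P[->|s1].
  by rewrite powRr1 // mul1r addrC subrK.
have t0 : 0 < 1 - s by rewrite subr_gt0.
have := @conjugate_powR _ (a `^ s) 1 s^-1 (1 - s)^-1 (powR_ge0 _ _) ler01.
rewrite !invr_gt0 !invrK mulr1 powR1 -powRrM mulfV ?gt_eqF // powRr1 // mul1r.
by move=> /(_ s0 t0) h; apply: le_trans (h _) _; [ring | lra].
Qed.

(** This ratio of consecutive products yields both monotonicity statements
    below: for s <= 1 the right-hand factor lies between 1 + s/(n+2) and
    1 + s/(n+1). *)
Lemma euler_seq_rec s n : 0 < s ->
  euler_seq s n.+1 * (1 + s / n.+2%:R) =
  euler_seq s n * (n.+2%:R / n.+1%:R) `^ s.
Proof.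
move=> s0; rewrite /euler_seq.
have n1 : n.+1%:R != 0 :> R by rewrite pnatr_eq0.
have n2 : n.+2%:R != 0 :> R by rewrite pnatr_eq0.
have sn := gt0_nonpole s0 n.+2; have p0 := prod_neq0 n.+2 (gt0_nonpole s0).
rewrite big_ord_recr /= [n.+2`!]factS natrM.
have -> : n.+2%:R `^ s = n.+1%:R `^ s * (n.+2%:R / n.+1%:R) `^ s.
  by rewrite -powRM ?divr_ge0 // mulrC divfK.
by field; rewrite -natrD n2 p0 sn.
Qed.

Lemma euler_seq_gt0 s n : 0 < s -> 0 < euler_seq s n.
Proof.
move=> s0; rewrite /euler_seq divr_gt0 //.
  by rewrite mulr_gt0 ?powR_gt0 ?ltr0n ?fact_gt0.
by apply: prodr_gt0 => j _; rewrite ltr_wpDr.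
Qed.

(** The products increase, while their multiples by 1 + s/(n+1) decrease, which
    bounds them; the limit is at least the first product, hence nonzero. *)
Lemma euler_cvg01 s : 0 < s <= 1 ->
  exists2 L, L != 0 & euler_seq s @ \oo --> (L : R^o).
Proof.
move=> s01; have /andP[s0 s1] := s01.
have ge1 n : 1 + s / n.+2%:R <= (n.+2%:R / n.+1%:R) `^ s.
  have n1 : 0 < n.+1%:R :> R by rewrite ltr0n.
  have n2 : 0 < n.+2%:R :> R by rewrite ltr0n.
  have -> : n.+2%:R / n.+1%:R = (n.+1%:R / n.+2%:R)^-1 :> R by rewrite invf_div.
  have r0 : 0 < n.+1%:R / n.+2%:R :> R by rewrite divr_gt0.
  set r := n.+1%:R / _ in r0 *.
  have -> : r^-1 `^ s = (r `^ s)^-1.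
    by rewrite -[r^-1]powR_inv1 ?ltW // -powRrM mulN1r powRN.
  rewrite -[leLHS]invrK lef_pV2 ?posrE ?powR_gt0 ?invr_gt0 //; last first.
    by rewrite addr_gt0 // divr_gt0.
  apply: le_trans (bernoulli_powR (ltW r0) s01) _; rewrite /r.
  have -> : n.+1%:R / n.+2%:R - 1 = - n.+2%:R^-1 :> R.
    by rewrite -[n.+1%:R](addrK 1) natr1; field; rewrite -natrD gt_eqF.
  rewrite -[leRHS]mul1r ler_pdivlMr; last by rewrite addr_gt0 // divr_gt0.
  have -> : (1 + s * - n.+2%:R^-1) * (1 + s / n.+2%:R) = 1 - (s / n.+2%:R) ^+ 2.
    by ring.
  by rewrite gerBl sqr_ge0.
have le1 n : (n.+2%:R / n.+1%:R) `^ s <= 1 + s / n.+1%:R.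
  have n1 : n.+1%:R != 0 :> R by rewrite pnatr_eq0.
  apply: le_trans (bernoulli_powR _ s01) _; first by rewrite divr_ge0.
  by rewrite -[n.+2%:R]natr1 mulrDl mulfV // mul1r [1 + _^-1]addrC addrK.
have fac0 n : 0 < 1 + s / n.+1%:R by rewrite addr_gt0 // divr_gt0 // ltr0n.
have up : nondecreasing_seq (euler_seq s).
  apply/nondecreasing_seqP => n; rewrite -(ler_pM2r (fac0 n.+1)) euler_seq_rec //.
  by rewrite ler_pM2l // euler_seq_gt0.
have down n : euler_seq s n * (1 + s / n.+1%:R) <= euler_seq s 0 * (1 + s / 1).
  elim: n => [//|n IHn]; rewrite euler_seq_rec //; apply: le_trans IHn.
  by rewrite ler_pM2l // euler_seq_gt0.
have ub : has_ubound (range (euler_seq s)).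
  exists (euler_seq s 0 * (1 + s / 1)) => _ [n _ <-]; apply: le_trans (down n).
  rewrite ler_peMr ?(ltW (euler_seq_gt0 _ s0)) // lerDl divr_ge0 // ltW //.
have cv := nondecreasing_is_cvgn up ub.
exists (limn (euler_seq s)) => //.
rewrite gt_eqF //; apply: lt_le_trans (euler_seq_gt0 0 s0) _.
exact: nondecreasing_cvgn_le.
Qed.

(** Every real number is at an integer distance from (0, 1]. *)
Lemma euler_cvg s : nonpole s ->
  exists2 L, L != 0 & euler_seq s @ \oo --> (L : R^o).
Proof.
pose conv s := exists2 L, L != 0 & euler_seq s @ \oo --> (L : R^o).
have nz t : nonpole t -> t != 0 by move=> /(_ 0%N); rewrite addr0.
have down n t : nonpole t -> conv (t + n%:R) -> conv t.
  elim: n t => [|n IHn] t t0; first by rewrite addr0.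
  rewrite -natr1 [_ + 1]addrC addrA => /(IHn _ (nonpoleD 1 t0))[L L0 cL].
  by exists (L / t); [apply: mulf_neq0 => //; rewrite invr_eq0 nz | apply: euler_cvg_down].
have up n t : nonpole t -> conv t -> conv (t + n%:R).
  elim: n t => [|n IHn] t t0; first by rewrite addr0.
  case=> L L0 cL; rewrite -natr1 [_ + 1]addrC addrA.
  apply: IHn; first exact: (nonpoleD 1).
  by exists (t * L); [apply: mulf_neq0 => //; apply: nz | apply: euler_cvg_up].
move=> s0; pose z := Num.ceil s - 1; pose t := s - z%:~R.
have t01 : 0 < t <= 1.
  have := ceil_itv s; rewrite -/z => /andP[zs].
  by rewrite -[Num.ceil s](subrK 1) -/z intrD /t; lra.
have ct := euler_cvg01 t01; have /andP[/gt0_nonpole t0 _] := t01.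
have : s = t + z%:~R by rewrite subrK.
case: z @t t01 ct t0 => n t t01 ct t0 es; first by rewrite es; apply: up.
apply: (down n.+1) => //.
by rewrite [X in conv X](_ : _ = t) // /t NegzE mulrNz opprK.
Qed.

Lemma Gamma_neq0 s : nonpole s -> Gamma s != 0.
Proof. by move=> /euler_cvg[L L0 cL]; rewrite (Gamma_lim cL). Qed.

Lemma GammaD1 s : nonpole s -> Gamma (s + 1) = s * Gamma s.
Proof.
move=> s0; have [L L0 cL] := euler_cvg s0.
by rewrite (Gamma_lim cL); apply/Gamma_lim/euler_cvg_up.
Qed.

Lemma GammaD_nat s n : nonpole s ->
  Gamma (n%:R + s) = \prod_(j < n) (s + j%:R) * Gamma s.
Proof.
move=> s0; elim: n => [|n IHn]; first by rewrite add0r big_ord0 mul1r.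
rewrite -natr1 addrAC GammaD1; last by rewrite addrC; apply: nonpoleD.
by rewrite IHn big_ord_recr /= mulrCA mulrA [n%:R + s]addrC mulrC !mulrA.
Qed.

End GammaLimit.
End GammaLimit.

From mathcomp Require Import mpoly.

(** * Canonical (anti)commutation relations on superpolynomials *)

Section SuperWeyl.
Variables (K : comNzRingType) (m n : nat).
Local Notation P := (superpoly K m n).
Local Notation X := (sp_even K n).
Local Notation theta := (sp_odd K m).
Local Notation dX := (@d_even K m n).
Local Notation dtheta := (@d_odd K m n).
Implicit Types (f g : P) (S : {set 'I_n}).

(** The parity of this number is the sign produced when theta_j is moved to its
    place in theta_S. *)
Definition below (j : 'I_n) S : nat := #|[set k in S | (k < j)%N]|.

Lemma sp_mulE f g S : (f * g) S =
  \sum_(A in powerset S) (-1) ^+ inversions A (S :\: A) * f A * g (S :\: A).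
Proof. by rewrite /GRing.mul /= ffunE. Qed.

Lemma sp_addE f g S : (f + g) S = f S + g S. Proof. by rewrite ffunE. Qed.
Lemma sp_oppE f S : (- f) S = - f S. Proof. by rewrite ffunE. Qed.
Lemma sp_scaleE (a : K) f S : (a *: f) S = a *: f S. Proof. by rewrite ffunE. Qed.
Lemma d_evenE i f S : (dX i f) S = (f S)^`M(i). Proof. by rewrite ffunE. Qed.
Lemma d_oddE j f S : (dtheta j f) S =
  if j \in S then 0 else (-1) ^+ below j S * f (j |: S).
Proof. by rewrite ffunE. Qed.
Let spE := (sp_addE, sp_oppE, sp_scaleE, d_evenE, d_oddE).

Fact sp_scaleAr (a : K) f g : a *: (f * g) = f * (a *: g).
Proof.
apply/ffunP => S; rewrite sp_scaleE !sp_mulE scaler_sumr.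
by apply: eq_bigr => A _; rewrite sp_scaleE scalerAr.
Qed.
HB.instance Definition _ := GRing.Lalgebra_isAlgebra.Build K P sp_scaleAr.

Lemma sp_evenM i f S : (X i * f) S = 'X_i * f S.
Proof.
rewrite sp_mulE (bigD1 finset.set0) ?powersetE ?sub0set //= big1 ?addr0.
  by rewrite ffunE eqxx setD0 /inversions big_set0 mul1r.
by move=> A /andP[_ /negPf nA]; rewrite ffunE nA mulr0 mul0r.
Qed.

Lemma sp_mul_even i f S : (f * X i) S = f S * 'X_i.
Proof.
rewrite sp_mulE (bigD1 S) ?powersetE //= big1 ?addr0.
  rewrite ffunE setDv eqxx /inversions big1 ?mul1r // => a _.
  by rewrite big_set0.
move=> A /andP[]; rewrite powersetE => sAS nA; rewrite ffunE setD_eq0.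
by rewrite eqEsubset sAS /= in nA; rewrite (negPf nA) mulr0.
Qed.

Lemma sp_evenC i f : X i * f = f * X i.
Proof. by apply/ffunP => S; rewrite sp_evenM sp_mul_even mulrC. Qed.

Lemma sp_oddM j f S : (theta j * f) S =
  if j \in S then (-1) ^+ below j S * f (S :\ j) else 0.
Proof.
rewrite sp_mulE; case: ifPn => jS; last first.
  rewrite big1 // => A; rewrite powersetE => sAS; rewrite ffunE.
  case: eqP => [eA|_]; last by rewrite mulr0 mul0r.
  by rewrite eA sub1set (negPf jS) in sAS.
rewrite (bigD1 [set j]) ?powersetE ?sub1set //= big1 ?addr0; last first.
  by move=> A /andP[_ /negPf nA]; rewrite ffunE nA mulr0 mul0r.
rewrite ffunE eqxx mulr1; congr ((-1) ^+ _ * _).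
rewrite /inversions big_set1 /below -sum1_card big_mkcond [RHS]big_mkcond /=.
apply: eq_bigr => b _; rewrite !inE; case: eqVneq => [->|] //=.
  by rewrite ltnn andbF.
by case: (b \in S); case: (b < j)%N.
Qed.

Lemma belowD1 (j k : 'I_n) S : k \in S ->
  below j S = ((k < j) + below j (S :\ k))%N.
Proof.
move=> kS; rewrite /below; case: ltnP => [kj|jk] /=.
  rewrite (cardsD1 k) inE kS kj add1n /=; congr _.+1.
  by apply: eq_card => i; rewrite !inE andbA.
apply: eq_card => i; rewrite !inE; case: eqVneq => //= ->.
by rewrite ltnNge jk andbF.
Qed.

(** Removing k from S changes the number of elements below j exactly when
    k < j, so the two orders of removal differ by one sign. *)
Lemma sp_odd_anti_mul j k f : theta j * (theta k * f) = - (theta k * (theta j * f)).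
Proof.
apply/ffunP => S; rewrite sp_oppE !sp_oddM !inE.
case: (eqVneq j k) => [->|njk] /=; first by rewrite mulr0 if_same oppr0.
case jS: (j \in S); case kS: (k \in S); rewrite ?mulr0 ?oppr0 //.
rewrite !mulrA -!exprD setDDl setUC -setDDl -mulNr; congr (_ * _).
rewrite (belowD1 j kS) (belowD1 k jS).
move: njk; rewrite -val_eqE neq_ltn => /orP[] lt; rewrite lt ltnNge (ltnW lt) /=.
  by rewrite add0n add1n addSn exprS mulN1r opprK addnC.
by rewrite add0n add1n addSn exprS mulN1r addnC.
Qed.

Lemma sp_odd_anti (j k : 'I_n) : theta j * theta k = - (theta k * theta j).
Proof. by have := sp_odd_anti_mul j k 1; rewrite !mulr1. Qed.

Lemma sp_odd_sqr (j : 'I_n) : theta j * theta j = 0.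
Proof.
apply/ffunP => S; rewrite sp_oddM !ffunE; case: ifP => // jS.
by case: eqP => [/setP/(_ j)|_]; rewrite ?mulr0 // !inE eqxx.
Qed.

Fact d_even_linear i : linear (dX i).
Proof.
by move=> a f g; apply/ffunP => S; rewrite !spE mderivD mderivZ.
Qed.
HB.instance Definition _ i := GRing.isLinear.Build K P P *:%R (dX i) (d_even_linear i).

Fact d_odd_linear j : linear (dtheta j).
Proof.
move=> a f g; apply/ffunP => S; rewrite !spE.
by case: ifP => _; rewrite ?scaler0 ?addr0 // mulrDr scalerAr.
Qed.
HB.instance Definition _ j := GRing.isLinear.Build K P P *:%R (dtheta j) (d_odd_linear j).

Lemma d_even_even i k f : dX i (X k * f) = (k == i)%:R *: f + X k * dX i f.
Proof.
apply/ffunP => S; rewrite !(spE, sp_evenM) mderivM mderivX mnm1E.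
have -> : (U_(k) - U_(i) = if k == i then 0 else U_(k) - U_(i))%MM.
  case: eqP => [->|//]; apply/mnmP => l; by rewrite mnmBE subnn mnm0E.
by case: eqP => _; rewrite ?scale0r ?mul0r // mpolyX0 !scale1r mul1r.
Qed.

Lemma d_even_odd i j f : dX i (theta j * f) = theta j * dX i f.
Proof.
apply/ffunP => S; rewrite !(spE, sp_oddM).
case: ifP => _; rewrite ?mderiv0 // -signr_odd.
by case: odd; rewrite ?expr1 ?expr0 ?mulN1r ?mul1r ?mderivN ?spE.
Qed.

Lemma d_odd_even j i f : dtheta j (X i * f) = X i * dtheta j f.
Proof.
by apply/ffunP => S; rewrite !(spE, sp_evenM); case: ifP => _; rewrite ?mulr0 // mulrCA.
Qed.

(** The Clifford relation between a left odd derivative and left multiplication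
    by an odd variable. *)
Lemma d_odd_odd j k f :
  dtheta j (theta k * f) = (k == j)%:R *: f - theta k * dtheta j f.
Proof.
have sgn2 e : (-1) ^+ e * (-1) ^+ e = 1 :> {mpoly K[m]}.
  by rewrite -exprMn mulrNN mulr1 expr1n.
have belowD j0 S : below j0 (S :\ j0) = below j0 S.
  case j0S: (j0 \in S); first by rewrite (belowD1 _ j0S) ltnn.
  by congr below; apply/setP => i; rewrite !inE; case: eqVneq => [->|].
apply/ffunP => S; rewrite !(spE, sp_oddM) !inE.
case: (eqVneq k j) => [->|nkj] /=.
  rewrite scale1r; case: ifPn => jS /=.
    by rewrite belowD setD1K // mulrA sgn2 mul1r subrr.
  rewrite subr0 setU1K // mulrA -(belowD _ (j |: S)) setU1K //.
  by rewrite sgn2 mul1r.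
rewrite scale0r add0r.
case: ifPn => jS; first by rewrite mulr0 if_same oppr0.
case: ifPn => kS; last by rewrite mulr0 oppr0.
have jkS : k \in j |: S by rewrite !inE kS orbT.
have jjS : j \in j |: S by rewrite !inE eqxx.
have -> : (j |: S) :\ k = j |: (S :\ k).
  apply/setP => i; rewrite !inE; case: (eqVneq i j) => [->|_] //.
  by rewrite ?(eq_sym j k) ?(negPf nkj).
rewrite (belowD1 k jjS) setU1K // (belowD1 j kS) !mulrA -!exprD -mulNr; congr (_ * _).
move: nkj; rewrite -val_eqE neq_ltn => /orP[] lt; rewrite lt ltnNge (ltnW lt) /=.
  by rewrite add0n add1n addSn exprS mulN1r addnC.
by rewrite add0n add1n addnS exprS mulN1r addnC.
Qed.
End SuperWeyl.

Lemma sp_oneE (K : comNzRingType) m n S :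
  (1 : superpoly K m n) S = (S == finset.set0)%:R.
Proof. by rewrite /GRing.one /= ffunE. Qed.
Lemma sp_0E (K : comNzRingType) m n S : (0 : superpoly K m n) S = 0.
Proof. by rewrite ffunE. Qed.

Lemma d_even1 (K : comNzRingType) m n (i : 'I_m) : d_even i (1 : superpoly K m n) = 0.
Proof.
apply/ffunP => S; rewrite d_evenE sp_oneE sp_0E.
by case: (S == _); rewrite -?mpolyC1 ?mderivC ?mderiv0.
Qed.

Lemma d_odd1 (K : comNzRingType) m n (j : 'I_n) : d_odd j (1 : superpoly K m n) = 0.
Proof.
apply/ffunP => S; rewrite d_oddE sp_oneE sp_0E; case: ifP => // _.
by rewrite [_ == _](_ : _ = false) ?mulr0 //; apply/eqP => /setP/(_ j); rewrite !inE eqxx.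
Qed.

Lemma d_evenC (K : comNzRingType) m n (i j : 'I_m) (f : superpoly K m n) :
  d_even i (d_even j f) = d_even j (d_even i f).
Proof. by apply/ffunP => S; rewrite !d_evenE mderiv_comm. Qed.

Lemma sp_sumE (K : comNzRingType) m n I (r : seq I) (Q : pred I)
    (F : I -> superpoly K m n) T :
  (\sum_(i <- r | Q i) F i) T = \sum_(i <- r | Q i) F i T.
Proof.
by apply: (big_morph (fun f : superpoly K m n => f T)) => [f g|];
  rewrite ?sp_addE ?sp_0E.
Qed.

(** * Identities between linear combinations *)

(** An identity between linear combinations of vectors follows from the equality
    of the coefficients of each vector.  The tactic below reifies both sides over
    the vectors that occur in them and leaves those scalar equations. *)
Section LinearCombinations.
Variables (K : comNzRingType) (V : lmodType K).

Inductive lincomb :=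
| LAtom of nat | LZero | LAdd of lincomb & lincomb | LOpp of lincomb
| LScale of K & lincomb.

Fixpoint leval (env : seq V) (e : lincomb) : V :=
  match e with
  | LAtom i => env`_i
  | LZero => 0
  | LAdd e1 e2 => leval env e1 + leval env e2
  | LOpp e1 => - leval env e1
  | LScale c e1 => c *: leval env e1
  end.

Fixpoint lcoef (e : lincomb) (i : nat) : K :=
  match e with
  | LAtom j => if (j == i)%N then 1 else 0
  | LZero => 0
  | LAdd e1 e2 => lcoef e1 i + lcoef e2 i
  | LOpp e1 => - lcoef e1 i
  | LScale c e1 => c * lcoef e1 i
  end.

Lemma levalE env e : leval env e = \sum_(i < size env) lcoef e i *: env`_i.
Proof.
elim: e => [j||e1 IH1 e2 IH2|e1 IH1|c e1 IH1] /=.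
- have [lt_j|le_j] := ltnP j (size env); last first.
    rewrite nth_default // big1 // => i _; case: eqP => [e|_]; rewrite ?scale0r //.
    by rewrite e leqNgt ltn_ord in le_j.
  rewrite (bigD1 (Ordinal lt_j)) //= eqxx scale1r big1 ?addr0 // => i.
  by rewrite -val_eqE /= eq_sym => /negPf ->; rewrite scale0r.
- by rewrite big1 // => i _; rewrite scale0r.
- by rewrite IH1 IH2 -big_split; apply: eq_bigr => i _; rewrite scalerDl.
- by rewrite IH1 -sumrN; apply: eq_bigr => i _; rewrite scaleNr.
- by rewrite IH1 scaler_sumr; apply: eq_bigr => i _; rewrite scalerA.
Qed.

Fixpoint lcoef_eq e1 e2 n :=
  if n is k.+1 then lcoef e1 k = lcoef e2 k /\ lcoef_eq e1 e2 k else True.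

Lemma lincomb_eq env e1 e2 :
  lcoef_eq e1 e2 (size env) -> leval env e1 = leval env e2.
Proof.
move=> eq12; rewrite !levalE; apply: eq_bigr => i _; congr (_ *: _).
elim: (size env) i eq12 => [[]//|n IHn] i /= [eqn eq12].
have := ltn_ord i; rewrite ltnS leq_eqVlt => /predU1P[->//|lt_in].
exact: (IHn (Ordinal lt_in)).
Qed.
End LinearCombinations.

(* Terms are compared up to conversion, since the same product may occur with
   different, convertible algebraic structures. *)
Ltac same_term x y :=
  lazymatch goal with _ =>
    match goal with
    | _ => let _ := match goal with _ => unify x y end in constr:(true)
    | _ => constr:(false)
    end
  end.
Ltac atom_in m env :=
  lazymatch env with
  | ?x :: ?s =>
      lazymatch same_term x m with true => constr:(true) | _ => atom_in m s end
  | _ => constr:(false)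
  end.
Ltac atoms_of t env :=
  lazymatch t with
  | GRing.add ?x ?y => let env := atoms_of x env in atoms_of y env
  | GRing.opp ?x => atoms_of x env
  | GRing.scale _ ?x => atoms_of x env
  | GRing.zero => env
  | _ => lazymatch atom_in t env with true => env | _ => constr:(t :: env) end
  end.
Ltac atom_index m env :=
  lazymatch env with
  | ?x :: ?s =>
      lazymatch same_term x m with
      | true => constr:(0%N)
      | _ => let i := atom_index m s in constr:(i.+1)
      end
  end.
Ltac reify K t env :=
  lazymatch t with
  | GRing.add ?x ?y =>
      let x := reify K x env in let y := reify K y env in constr:(@LAdd K x y)
  | GRing.opp ?x => let x := reify K x env in constr:(@LOpp K x)
  | GRing.scale ?c ?x => let x := reify K x env in constr:(@LScale K c x)
  | GRing.zero => constr:(@LZero K)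
  | _ => let i := atom_index t env in constr:(@LAtom K i)
  end.
Ltac linear_identity K V solver :=
  lazymatch goal with
  | |- ?x = ?y =>
    let env := atoms_of x (@nil (GRing.Lmodule.sort V)) in
    let env := atoms_of y env in
    let ex := reify K x env in
    let ey := reify K y env in
    refine (@lincomb_eq K V env ex ey _);
    cbn [lcoef_eq lcoef size eq_op]; simpl (if _ then _ else _);
    repeat (split; [solver|]); exact I
  end.

(** * Order of vanishing *)

(** [zfilt n f] says that f lies in the n-th power of the left ideal generated
    by Z.  The inductive form makes the stability of this filtration under
    derivations a structural induction. *)
Section Filtration.
Variables (K : numFieldType) (P : algType K) (Z : seq P).
Implicit Types (f g z : P) (L : P -> P).

Inductive zfilt : nat -> P -> Prop :=
| zfilt_any f : zfilt 0 f
| zfilt_mul n z f of z \in Z & zfilt n f : zfilt n.+1 (z * f)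
| zfilt_lin n c f g of zfilt n f & zfilt n g : zfilt n (c *: f + g)
| zfilt0 n : zfilt n 0
| zfiltW n f of zfilt n.+1 f : zfilt n f.

Lemma zfilt_le m n f : (m <= n)%N -> zfilt n f -> zfilt m f.
Proof.
elim: n => [|n IHn]; first by rewrite leqn0 => /eqP ->.
by rewrite leq_eqVlt => /predU1P[->|lt_mn] // /zfiltW; apply: IHn.
Qed.

Lemma zfiltD n f g : zfilt n f -> zfilt n g -> zfilt n (f + g).
Proof. by move=> zf zg; rewrite -[f]scale1r; apply: zfilt_lin. Qed.
Lemma zfiltZ n c f : zfilt n f -> zfilt n (c *: f).
Proof. by move=> zf; rewrite -[c *: f]addr0; apply/zfilt_lin/zfilt0. Qed.
Lemma zfiltN n f : zfilt n f -> zfilt n (- f).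
Proof. by move=> zf; rewrite -scaleN1r; apply: zfiltZ. Qed.

Lemma zfilt_derivation n L f : linear L ->
  (forall z, z \in Z -> exists c s, forall g, L (z * g) = c *: g + s *: (z * L g)) ->
  zfilt n f -> zfilt n.-1 (L f).
Proof.
move=> lL LZ; elim=> {n f} [f|n z f zZ zf IHf|n c f g _ IHf _ IHg|n|n f _ IHf].
- exact: zfilt_any.
- have [c [s ->]] := LZ z zZ; apply: zfilt_lin => //; apply: zfiltZ.
  by case: n zf IHf => [|n] zf IHf; [apply: zfilt_any | apply: zfilt_mul].
- by rewrite lL; apply: zfilt_lin.
- have := lL (-1) 0 0; rewrite scaler0 addr0 scaleN1r addNr => ->; exact: zfilt0.
- exact: zfilt_le (leq_pred n) IHf.
Qed.

Lemma zfilt_supercommuting n L f : linear L ->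
  (forall z, z \in Z -> exists s, forall g, L (z * g) = s *: (z * L g)) ->
  zfilt n f -> zfilt n (L f).
Proof.
move=> lL LZ; elim=> {n f} [f|n z f zZ zf IHf|n c f g _ IHf _ IHg|n|n f _ IHf].
- exact: zfilt_any.
- by have [s ->] := LZ z zZ; apply/zfiltZ/zfilt_mul.
- by rewrite lL; apply: zfilt_lin.
- have := lL (-1) 0 0; rewrite scaler0 addr0 scaleN1r addNr => ->; exact: zfilt0.
- exact: zfiltW IHf.
Qed.

Lemma zfilt_eval (Q : lmodType K) (ev : {linear P -> Q}) n f :
  (forall z g, z \in Z -> ev (z * g) = 0) -> (0 < n)%N -> zfilt n f -> ev f = 0.
Proof.
move=> evZ + zf; elim: zf => {n f} [//|n z f zZ _ _ _|n c f g _ IHf _ IHg n0|n _|n f _ IHf _].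
- exact: evZ.
- by rewrite linearP IHf // IHg // scaler0 addr0.
- exact: linear0.
- exact: IHf.
Qed.
End Filtration.

(** * Bessel operators on powers of the pairing *)

(** The generators and the derivations are kept abstract and enter through their
    commutation relations only.  The indices i1, i2, j3, j4 are those of the
    variables z and k1, k2, l3, l4 those of w.  The operators below are the
    family with parameters (a, b) that contains both cases of the theorem. *)
Section GenericBessel.
Variables (K : numFieldType) (P : algType K) (I J : eqType).
Variables (X : I -> P) (theta : J -> P).
Variables (dX : I -> {linear P -> P}) (dtheta : J -> {linear P -> P}).
Hypothesis XC : forall i f, X i * f = f * X i.
Hypothesis thetaN : forall i j, theta i * theta j = - (theta j * theta i).
Hypothesis theta2 : forall i, theta i * theta i = 0.
Hypothesis dX1 : forall i, dX i 1 = 0.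
Hypothesis dtheta1 : forall j, dtheta j 1 = 0.
Hypothesis dXX : forall i k f, dX i (X k * f) = (k == i)%:R *: f + X k * dX i f.
Hypothesis dXtheta : forall i j f, dX i (theta j * f) = theta j * dX i f.
Hypothesis dthetaX : forall j i f, dtheta j (X i * f) = X i * dtheta j f.
Hypothesis dtheta2 : forall j k f,
  dtheta j (theta k * f) = (k == j)%:R *: f - theta k * dtheta j f.
Variables (a b : K) (i1 i2 k1 k2 : I) (j3 j4 l3 l4 : J).
Hypothesis a0 : a != 0.
Hypothesis uniqI : uniq [:: i1; i2; k1; k2].
Hypothesis uniqJ : uniq [:: j3; j4; l3; l4].
Implicit Types (f g h q : P).

Local Notation Z1 := (X i1).
Local Notation Z2 := (X i2).
Local Notation W1 := (X k1).
Local Notation W2 := (X k2).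
Local Notation T3 := (theta j3).
Local Notation T4 := (theta j4).
Local Notation V3 := (theta l3).
Local Notation V4 := (theta l4).
Local Notation D1 := (dX i1).
Local Notation D2 := (dX i2).
Local Notation D3 := (dtheta j3).
Local Notation D4 := (dtheta j4).

Definition pairing : P :=
  a *: (Z1 * W1) + b *: (Z2 * W2) - 2^-1 *: (T3 * V4) + 2^-1 *: (T4 * V3).
Local Notation x := pairing.

Definition gbessel1 q := - (b / a) *: D1 q + Z1 * D1 (D1 q) + T3 * D3 (D1 q)
  + T4 * D4 (D1 q) - (2 * b) *: (Z2 * D3 (D4 q)).
Definition gbessel2 q := -1 *: D2 q + Z2 * D2 (D2 q) + T3 * D3 (D2 q)
  + T4 * D4 (D2 q) - (2 * a) *: (Z1 * D3 (D4 q)).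
Definition gbessel3 q := - (2 * b) *: D4 q + (2 * a) *: (Z1 * D1 (D4 q))
  + (2 * b) *: (Z2 * D2 (D4 q)) + (2 * (a + b)) *: (T3 * D3 (D4 q))
  + T3 * D1 (D2 q).
Definition gbessel4 q := (2 * b) *: D3 q - (2 * a) *: (Z1 * D1 (D3 q))
  - (2 * b) *: (Z2 * D2 (D3 q)) - (2 * (a + b)) *: (T4 * D4 (D3 q))
  + T4 * D1 (D2 q).

(* Monomials are brought to the order z1 z2 w1 w2 z3 z4 w3 w4; a rule is stated
   for each wrongly ordered pair, so that rewriting terminates. *)
Let evenAC i j f : X i * (X j * f) = X j * (X i * f).
Proof. by rewrite !mulrA [X in X * f]XC. Qed.
Let odd_even i j f : theta j * (X i * f) = X i * (theta j * f).
Proof. by rewrite !mulrA [X in _ = X * f]XC. Qed.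
Let odd_anti i j f : theta i * (theta j * f) = - (theta j * (theta i * f)).
Proof. by rewrite !mulrA thetaN mulNr. Qed.
Let odd_sqr j f : theta j * (theta j * f) = 0.
Proof. by rewrite mulrA theta2 mul0r. Qed.

Let sort_even :=
  (evenAC i2 i1, evenAC k1 i1, evenAC k2 i1, evenAC k1 i2, evenAC k2 i2,
   evenAC k2 k1).
Let sort_odd :=
  (odd_anti j4 j3, odd_anti l3 j3, odd_anti l4 j3, odd_anti l3 j4,
   odd_anti l4 j4, odd_anti l4 l3).

Let neqI : ((i2 == i1) = false) * ((k1 == i1) = false) * ((k2 == i1) = false)
  * ((i1 == i2) = false) * ((k1 == i2) = false) * ((k2 == i2) = false).
Proof.
move: uniqI; rewrite /= !inE !negb_or => /and4P[/and3P[n1 n2 n3] /andP[n4 n5] _ _].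
have sym (u v : I) : u != v -> ((u == v) = false) * ((v == u) = false).
  by move=> /negPf uv; rewrite [v == u]eq_sym uv.
by rewrite !(sym _ _ n1, sym _ _ n2, sym _ _ n3, sym _ _ n4, sym _ _ n5).
Qed.
Let neqJ : ((j4 == j3) = false) * ((l3 == j3) = false) * ((l4 == j3) = false)
  * ((j3 == j4) = false) * ((l3 == j4) = false) * ((l4 == j4) = false).
Proof.
move: uniqJ; rewrite /= !inE !negb_or => /and4P[/and3P[n1 n2 n3] /andP[n4 n5] _ _].
have sym (u v : J) : u != v -> ((u == v) = false) * ((v == u) = false).
  by move=> /negPf uv; rewrite [v == u]eq_sym uv.
by rewrite !(sym _ _ n1, sym _ _ n2, sym _ _ n3, sym _ _ n4, sym _ _ n5).
Qed.

Ltac expand := rewrite ?(mulrDl, mulrDr, mulNr, mulrN, =^~ scalerAl, =^~ scalerAr) -?mulrA.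
Ltac sort := rewrite ?(odd_even, odd_sqr, sort_even, sort_odd, mulrN, mulr0, mul0r).
Ltac derive := rewrite ?(linearD, linearN, linearZ, dXX, dXtheta, dthetaX, dtheta2) /=
  ?(eqxx, neqI, neqJ) /= ?(mulr1n, mulr0n, scale1r, scale0r, add0r).
Ltac linear_combination := linear_identity K P ltac:(by field; rewrite ?a0).

Let D1x f : D1 (x * f) = (a *: W1) * f + x * D1 f.
Proof. by rewrite /pairing; expand; derive; linear_combination. Qed.
Let D2x f : D2 (x * f) = (b *: W2) * f + x * D2 f.
Proof. by rewrite /pairing; expand; derive; linear_combination. Qed.
Let D3x f : D3 (x * f) = (- (2^-1 *: V4)) * f + x * D3 f.
Proof. by rewrite /pairing; expand; derive; expand; sort; linear_combination. Qed.
Let D4x f : D4 (x * f) = (2^-1 *: V3) * f + x * D4 f.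
Proof. by rewrite /pairing; expand; derive; expand; sort; linear_combination. Qed.

Let xX i f : x * (X i * f) = X i * (x * f).
Proof. by rewrite !mulrA XC. Qed.
Let xV3 f : x * (V3 * f) = V3 * (x * f).
Proof. by rewrite /pairing; expand; sort; linear_combination. Qed.
Let xV4 f : x * (V4 * f) = V4 * (x * f).
Proof. by rewrite /pairing; expand; sort; linear_combination. Qed.

(** The power rule; at k = 0 the meaningless exponent k.-1 is killed by the
    scalar k. *)
Lemma derivation_exp (D : {linear P -> P}) (u y : P) k :
  D 1 = 0 -> (forall f, D (y * f) = u * f + y * D f) ->
  (forall f, y * (u * f) = u * (y * f)) ->
  D (y ^+ k) = k%:R *: (u * y ^+ k.-1).
Proof.
move=> D1 Dy yu; elim: k => [|k IHk]; first by rewrite D1 scale0r.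
rewrite exprS Dy IHk -scalerAr yu -exprS -natr1 scalerDl scale1r addrC /=.
by case: k {IHk} => [|k]; rewrite ?scale0r.
Qed.

Let D1exp k : D1 (x ^+ k) = (k%:R * a) *: (W1 * x ^+ k.-1).
Proof.
rewrite (derivation_exp (u := a *: W1)) // => [|f]; first by rewrite -scalerAl scalerA.
by rewrite -!scalerAl -scalerAr xX.
Qed.
Let D2exp k : D2 (x ^+ k) = (k%:R * b) *: (W2 * x ^+ k.-1).
Proof.
rewrite (derivation_exp (u := b *: W2)) // => [|f]; first by rewrite -scalerAl scalerA.
by rewrite -!scalerAl -scalerAr xX.
Qed.
Let D3exp k : D3 (x ^+ k) = (- (k%:R / 2)) *: (V4 * x ^+ k.-1).
Proof.
rewrite (derivation_exp (u := - (2^-1 *: V4))) // => [|f].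
  by rewrite -scaleNr -scalerAl scalerA mulrN.
by rewrite !mulNr -!scalerAl mulrN -scalerAr xV4.
Qed.
Let D4exp k : D4 (x ^+ k) = (k%:R / 2) *: (V3 * x ^+ k.-1).
Proof.
rewrite (derivation_exp (u := 2^-1 *: V3)) // => [|f]; first by rewrite -scalerAl scalerA.
by rewrite -!scalerAl -scalerAr xV3.
Qed.

Definition rel_gen : P := (2 * a) *: (W1 * W2) + V3 * V4.

(** Membership in the ideal generated by the relations in w, written as a right
    ideal: that is the ideal itself, since its generators commute or anticommute
    with all variables. *)
Definition in_relations q := exists h1 h2 h3 h4,
  q = rel_gen * h1 + W2 ^+ 2 * h2 + W2 * V3 * h3 + W2 * V4 * h4.

(** The scalar by which a Bessel operator acts on the k-th power of the
    pairing. *)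
Definition eigen k : K := k%:R * (k.-1%:R * a - b).

(* One factor x is split off from x^(k-1), because the second derivatives of x^k
   come with x^(k-2).  For k < 2 the coefficient of that term is 0. *)
Let eigenE k f : eigen k *: (f * x ^+ k.-1) =
  - (k%:R * b) *: (f * x ^+ k.-1) + (k%:R * k.-1%:R * a) *: (f * (x * x ^+ k.-2)).
Proof.
rewrite /eigen; case: k => [|[|k]] /=.
- by rewrite !mul0r oppr0 !scale0r addr0.
- by rewrite !mulr0n mulr0 !mul0r scale0r addr0 sub0r mulrN.
- by rewrite -exprS -scalerDl; congr (_ *: _); ring.
Qed.

Ltac diagonal := rewrite eigenE /rel_gen ?expr2 /gbessel1 /gbessel2 /gbessel3
  /gbessel4 ?(D1exp, D2exp, D3exp, D4exp, linearZ) /=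
  ?(dXX, dXtheta, dthetaX, dtheta2) ?(neqI, neqJ) /= ?(scale0r, add0r)
  ?(D1exp, D2exp, D3exp, D4exp).

(** The first derivatives of x^k give -k b w_i x^(k-1).  In the second
    derivatives one looks for a k (k-1) w_i x x^(k-2), and the four lemmas differ
    in the multiples of the relations that this leaves.  For the first operator
    that multiple comes from the term b z_2 w_2 of x and from the term of the
    operator in the two odd derivatives. *)
Lemma gbessel1_exp k : in_relations (gbessel1 (x ^+ k) - eigen k *: (W1 * x ^+ k.-1)).
Proof.
exists ((- (k%:R * k.-1%:R * b / 2)) *: (Z2 * x ^+ k.-2)), 0, 0, 0.
diagonal; set f := x ^+ k.-2; set g := x ^+ k.-1.
by rewrite /pairing; expand; sort; linear_combination.
Qed.

(** Here all terms of w_2 x except a z_1 w_1 w_2 contain one of the relations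
    w_2^2, w_2 w_3, w_2 w_4, and w_1 w_2 is traded for w_3 w_4 by the first
    relation. *)
Lemma gbessel2_exp k : in_relations (gbessel2 (x ^+ k) - eigen k *: (W2 * x ^+ k.-1)).
Proof.
pose Q : K := k%:R * k.-1%:R; pose f := x ^+ k.-2.
exists ((- (Q * a / 2)) *: (Z1 * f)), ((Q * (b - a) * b) *: (Z2 * f)),
  ((- (Q * (b - a) / 2)) *: (T4 * f)), ((Q * (b - a) / 2) *: (T3 * f)).
diagonal; rewrite -/f /Q; move: f => f; set g := x ^+ k.-1.
by rewrite /pairing; expand; sort; linear_combination.
Qed.

Lemma gbessel3_exp k : in_relations (gbessel3 (x ^+ k) - eigen k *: (V3 * x ^+ k.-1)).
Proof.
pose Q : K := k%:R * k.-1%:R; pose f := x ^+ k.-2.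
exists ((Q * b / 2) *: (T3 * f)), 0, ((Q * b * (b - a)) *: (Z2 * f)), 0.
diagonal; rewrite -/f /Q; move: f => f; set g := x ^+ k.-1.
by rewrite /pairing; expand; sort; linear_combination.
Qed.

Lemma gbessel4_exp k : in_relations (gbessel4 (x ^+ k) - eigen k *: (V4 * x ^+ k.-1)).
Proof.
pose Q : K := k%:R * k.-1%:R; pose f := x ^+ k.-2.
exists ((Q * b / 2) *: (T4 * f)), 0, 0, ((Q * b * (b - a)) *: (Z2 * f)).
diagonal; rewrite -/f /Q; move: f => f; set g := x ^+ k.-1.
by rewrite /pairing; expand; sort; linear_combination.
Qed.

Lemma linear_scale (L : P -> P) c f : linear L -> L (c *: f) = c *: L f.
Proof.
move=> lL; have L0 : L 0 = 0.
  by have := lL (-1) 0 0; rewrite scaler0 addr0 scaleN1r addNr.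
by have := lL c f 0; rewrite !addr0 L0 addr0.
Qed.
Lemma linear_add (L : P -> P) f g : linear L -> L (f + g) = L f + L g.
Proof. by move=> lL; have := lL 1 f g; rewrite !scale1r. Qed.

(** L commutes with w_1 and w_2, and commutes with w_3 and w_4 up to the sign s:
    this is how an operator of parity s that only involves z behaves, and also
    how multiplication by a monomial in w does. *)
Definition w_supercommuting s (L : P -> P) := [/\ linear L,
  forall f, L (W1 * f) = W1 * L f, forall f, L (W2 * f) = W2 * L f,
  forall f, L (V3 * f) = s *: (V3 * L f) & forall f, L (V4 * f) = s *: (V4 * L f)].

Lemma in_relations_lin c f g : in_relations f -> in_relations g -> in_relations (c *: f + g).
Proof.
case=> [f1 [f2 [f3 [f4 ->]]]] [g1 [g2 [g3 [g4 ->]]]].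
exists (c *: f1 + g1), (c *: f2 + g2), (c *: f3 + g3), (c *: f4 + g4).
rewrite !mulrDr -!scalerAr !scalerDr.
move: (rel_gen * _) (rel_gen * _) (W2 ^+ 2 * _) (W2 ^+ 2 * _) => u1 v1 u2 v2.
move: (W2 * _ * _) (W2 * _ * _) (W2 * _ * _) (W2 * _ * _) => u3 v3 u4 v4.
by linear_combination.
Qed.

Lemma in_relationsB q : in_relations (q - q).
Proof. by exists 0, 0, 0, 0; rewrite !mulr0 !addr0 subrr. Qed.

(** Each relation is a product of w variables, so L passes through it. *)
Lemma in_relations_op s L q : s * s = 1 -> w_supercommuting s L ->
  in_relations q -> in_relations (L q).
Proof.
move=> ss [lL L1 L2 L3 L4] [h1 [h2 [h3 [h4 ->]]]].
exists (L h1), (L h2), (s *: L h3), (s *: L h4).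
rewrite !(linear_add _ _ lL) /rel_gen expr2 !mulrDl -!scalerAl -!mulrA.
rewrite !(linear_add _ _ lL) (linear_scale _ _ lL) L1 !L2 !(L3, L4).
by rewrite -!scalerAr scalerA ss scale1r.
Qed.

(* The derivatives are pushed inside twice, for the operators of order two. *)
Ltac commute_w := split; [move=> c f g | move=> f ..];
  rewrite /gbessel1 /gbessel2 /gbessel3 /gbessel4
    ?(linearD, linearN, linearZ, dXX, dXtheta, dthetaX, dtheta2) /=
    ?(neqI, neqJ) /=
    ?(linearD, linearN, linearZ, scale0r, add0r, dXX, dXtheta, dthetaX, dtheta2) /=
    ?(neqI, neqJ) /= ?(scale0r, add0r);
  expand; sort; linear_combination.

Lemma gbessel1_supercommuting : w_supercommuting 1 gbessel1.
Proof. by commute_w. Qed.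
Lemma gbessel2_supercommuting : w_supercommuting 1 gbessel2.
Proof. by commute_w. Qed.
Lemma gbessel3_supercommuting : w_supercommuting (-1) gbessel3.
Proof. by commute_w. Qed.
Lemma gbessel4_supercommuting : w_supercommuting (-1) gbessel4.
Proof. by commute_w. Qed.
Lemma W1_supercommuting : w_supercommuting 1 ( *%R W1). Proof. by commute_w. Qed.
Lemma W2_supercommuting : w_supercommuting 1 ( *%R W2). Proof. by commute_w. Qed.
Lemma V3_supercommuting : w_supercommuting (-1) ( *%R V3). Proof. by commute_w. Qed.
Lemma V4_supercommuting : w_supercommuting (-1) ( *%R V4). Proof. by commute_w. Qed.

Definition eigen_on (B : P -> P) (w : P) :=
  forall k, in_relations (B (x ^+ k) - eigen k *: (w * x ^+ k.-1)).

Lemma in_relations_eval (Q : algType K) (ev : {linear P -> Q}) (u1 u2 v3 v4 : Q) f :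
  (forall g, ev (W1 * g) = u1 * ev g) -> (forall g, ev (W2 * g) = u2 * ev g) ->
  (forall g, ev (V3 * g) = v3 * ev g) -> (forall g, ev (V4 * g) = v4 * ev g) ->
  in_relations f -> exists h1 h2 h3 h4 : Q, ev f =
    ((2 * a) *: (u1 * u2) + v3 * v4) * h1 + u2 ^+ 2 * h2 + u2 * v3 * h3 + u2 * v4 * h4.
Proof.
move=> ev1 ev2 ev3 ev4 [h1 [h2 [h3 [h4 ->]]]].
exists (ev h1), (ev h2), (ev h3), (ev h4).
rewrite /rel_gen; move: (2 * a) => c.
rewrite !expr2 !mulrDl -!scalerAl -!mulrA !linearD linearZ /=.
by rewrite ev1 !ev2 !ev3 !ev4.
Qed.

(** One Bessel operator B, attached to w, applied to q that is congruent to a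
    multiple of M x^k, where M is multiplication by a monomial in w.  Moving B
    through M costs the sign t, and putting w in front of M costs the same sign,
    so that the signs cancel. *)
Lemma diagonal_step s t r c B w M q k :
  s * s = 1 -> t * t = 1 -> r * r = 1 ->
  w_supercommuting s B -> w_supercommuting r M -> eigen_on B w ->
  (forall f, B (M f) = t *: M (B f)) -> (forall f, M (w * f) = t *: (w * M f)) ->
  in_relations (q - c *: M (x ^+ k)) ->
  in_relations (B q - (c * eigen k) *: (w * M (x ^+ k.-1))).
Proof.
move=> ss tt rr slB slM diag BM Mw vq; have [lB _ _ _ _] := slB; have [lM _ _ _ _] := slM.
have -> : B q - (c * eigen k) *: (w * M (x ^+ k.-1)) =
    (c * t) *: M (B (x ^+ k) - eigen k *: (w * x ^+ k.-1)) + B (q - c *: M (x ^+ k)).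
  rewrite -[- (eigen k *: _)]scaleNr -[- (c *: M _)]scaleNr.
  rewrite [_ + - eigen k *: _]addrC lM [q + _]addrC lB BM Mw.
  move: (B q) (M (B _)) (w * M _) => u v z.
  by linear_identity K P ltac:(by ring: tt).
apply: in_relations_lin; first exact: (in_relations_op rr slM (diag k)).
exact: (in_relations_op ss slB vq).
Qed.

(** The scalar collected by n successive Bessel operators on x^k.  The truncated
    subtraction is harmless: for k < n the product contains [eigen 0], which
    is 0. *)
Definition falling n k : K := \prod_(i < n) eigen (k - i).

Lemma falling_gt n k : (k < n)%N -> falling n k = 0.
Proof.
move=> lt_kn; rewrite /falling (bigD1 (Ordinal lt_kn)) //= subnn.
by rewrite /eigen !mul0r.
Qed.

Lemma falling_diag n : falling n n = n`!%:R * \prod_(j < n) (j%:R * a - b).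
Proof.
rewrite /falling (reindex_inj rev_ord_inj) /=.
under eq_bigr => i _ do rewrite subKn // /eigen /=.
by rewrite big_split /= -natr_prod fact_prod big_add1 big_mkord.
Qed.

Lemma supercommuting_comp s1 s2 L1 L2 :
  w_supercommuting s1 L1 -> w_supercommuting s2 L2 ->
  w_supercommuting (s1 * s2) (L1 \o L2).
Proof.
move=> [lL1 p1 p2 p3 p4] [lL2 q1 q2 q3 q4]; split=> [c f g|f|f|f|f] /=.
- by rewrite lL2 lL1.
- by rewrite q1 p1.
- by rewrite q2 p2.
- by rewrite q3 (linear_scale _ _ lL1) p3 scalerA mulrC.
- by rewrite q4 (linear_scale _ _ lL1) p4 scalerA mulrC.
Qed.

Lemma supercommuting_id : w_supercommuting 1 id.
Proof. by split=> [c f g|f|f|f|f]; rewrite ?scale1r. Qed.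

Lemma supercommuting_iter n L : w_supercommuting 1 L -> w_supercommuting 1 (iter n L).
Proof.
move=> sL; elim: n => [|n IHn]; first exact: supercommuting_id.
by have := supercommuting_comp sL IHn; rewrite mulr1.
Qed.

Lemma diagonal_iter r c B w M q k m n :
  r * r = 1 -> w_supercommuting 1 B -> w_supercommuting 1 ( *%R w) ->
  w_supercommuting r M ->
  eigen_on B w ->
  (forall f, B (w * f) = w * B f) -> (forall f, B (M f) = M (B f)) ->
  (forall f, M (w * f) = w * M f) ->
  in_relations (q - (c * falling m k) *: M (x ^+ (k - m))) ->
  in_relations (iter n B q -
    (c * falling (n + m) k) *: iter n ( *%R w) (M (x ^+ (k - (n + m))))).
Proof.
move=> rr slB slw slM diag Bw BM Mw vq; elim: n => [//|n IHn].
rewrite /= addSn subnS /falling big_ord_recr /= mulrA.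
apply: (@diagonal_step 1 1 r (c * falling (n + m) k) B w (iter n ( *%R w) \o M)) => //;
  rewrite ?mulr1 //.
- by have := supercommuting_comp (supercommuting_iter n slw) slM; rewrite mul1r.
- move=> f /=; rewrite scale1r -BM; elim: n {IHn} => //= n <-; exact: Bw.
- by move=> f /=; rewrite scale1r Mw; elim: n {IHn} => //= n ->.
Qed.

(** The flag i tells which even operator is applied last.  A monomial always
    means B(z_1)^n1 B(z_2)^n2 ..., and exchanging the indices 1 and 2 turns this
    into the other order. *)
Definition even_bessel (i : bool) := if i then gbessel1 else gbessel2.
Definition even_w (i : bool) := if i then W1 else W2.

Definition bessel_word (i : bool) (n1 n2 : nat) (e3 e4 : bool) q :=
  iter n1 (even_bessel i) (iter n2 (even_bessel (~~ i))
    (iter e3 gbessel3 (iter e4 gbessel4 q))).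
Definition w_word (i : bool) (n1 n2 : nat) (e3 e4 : bool) q :=
  iter n1 ( *%R (even_w i)) (iter n2 ( *%R (even_w (~~ i)))
    (iter e3 ( *%R V3) (iter e4 ( *%R V4) q))).

Lemma bessel_word_linear i n1 n2 e3 e4 : linear (bessel_word i n1 n2 e3 e4).
Proof.
have it n (L : P -> P) : linear L -> linear (iter n L).
  by move=> lL; elim: n => // n IHn c f g; rewrite !iterS IHn lL.
have lin3 : linear gbessel3 by have [] := gbessel3_supercommuting.
have lin4 : linear gbessel4 by have [] := gbessel4_supercommuting.
have lE j : linear (even_bessel j).
  by case: j; [have [] := gbessel1_supercommuting | have [] := gbessel2_supercommuting].
by move=> c f g; rewrite /bessel_word (it _ _ lin4) (it _ _ lin3) !(it _ _ (lE _)).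
Qed.

(** The operators are applied from the last to the first: [diagonal_step] handles
    the two odd ones and [diagonal_iter] the powers of the two even ones. *)
Lemma bessel_word_exp (i : bool) (n1 n2 : nat) (e3 e4 : bool) (k : nat) :
  let n := (n1 + (n2 + (e3 + e4)))%N in
  in_relations (bessel_word i n1 n2 e3 e4 (x ^+ k)
    - falling n k *: w_word i n1 n2 e3 e4 (x ^+ (k - n))).
Proof.
have s1 : (-1) * (-1) = 1 :> K by rewrite mulrNN mulr1.
have odd4 : in_relations (iter e4 gbessel4 (x ^+ k)
    - falling e4 k *: iter e4 ( *%R V4) (x ^+ (k - e4))).
  case: e4 => /=; last by rewrite /falling big_ord0 scale1r subn0; apply: in_relationsB.
  by rewrite /falling big_ord1 subn0 subn1; apply: gbessel4_exp.
have s4 : w_supercommuting (if e4 then -1 else 1) (iter e4 ( *%R V4)).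
  by case: e4 {odd4}; [apply: V4_supercommuting | apply: supercommuting_id].
have s4s : (if e4 then -1 else 1) * (if e4 then -1 else 1) = 1 :> K.
  by case: e4 {odd4 s4}; rewrite ?mulr1.
have odd3 : in_relations (iter e3 gbessel3 (iter e4 gbessel4 (x ^+ k))
    - (1 * falling (e3 + e4) k) *:
      (iter e3 ( *%R V3) \o iter e4 ( *%R V4)) (x ^+ (k - (e3 + e4)))).
  rewrite mul1r; case: e3 => //=; rewrite add1n /falling big_ord_recr /= subnS.
  apply: (diagonal_step s1 s4s s4s gbessel3_supercommuting s4 gbessel3_exp _ _ odd4).
    have [_ _ _ _ B3V4] := gbessel3_supercommuting.
    by case: e4 {odd4 s4 s4s} => f /=; rewrite ?scale1r ?B3V4.
  have [_ _ _ V43 _] := V4_supercommuting.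
  by case: e4 {odd4 s4 s4s} => f /=; rewrite ?scale1r ?V43.
set M := iter e3 ( *%R V3) \o iter e4 ( *%R V4) in odd3.
pose r : K := (if e3 then -1 else 1) * (if e4 then -1 else 1).
have s3 : w_supercommuting (if e3 then -1 else 1) (iter e3 ( *%R V3)).
  by case: e3 {odd3 M r}; [apply: V3_supercommuting | apply: supercommuting_id].
have sM : w_supercommuting r M := supercommuting_comp s3 s4.
have rr : r * r = 1 by rewrite /r mulrACA s4s mulr1; case: (e3); rewrite ?mulr1.
have BM B : w_supercommuting 1 B -> forall f, B (M f) = M (B f).
  move=> [_ _ _ BV3 BV4] f; rewrite /M /=.
  by case: (e3); case: (e4) => /=; rewrite ?BV3 ?scale1r ?BV4 ?scale1r.
have MX j f : M (X j * f) = X j * M f.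
  by rewrite /M /=; case: (e3); case: (e4) => /=; rewrite ?odd_even.
have sB j : w_supercommuting 1 (even_bessel j).
  by case: j; [apply: gbessel1_supercommuting | apply: gbessel2_supercommuting].
have sW j : w_supercommuting 1 ( *%R (even_w j)).
  by case: j; [apply: W1_supercommuting | apply: W2_supercommuting].
have B_exp j : eigen_on (even_bessel j) (even_w j).
  by case: j; [apply: gbessel1_exp | apply: gbessel2_exp].
have Bw j l f : even_bessel j (even_w l * f) = even_w l * even_bessel j f.
  by have [_ Bw1 Bw2 _ _] := sB j; case: l.
have Mw j f : M (even_w j * f) = even_w j * M f by case: j; apply: MX.
have even2 := diagonal_iter n2 rr (sB (~~ i)) (sW (~~ i)) sM (B_exp (~~ i))
  (Bw (~~ i) (~~ i)) (BM _ (sB (~~ i))) (Mw (~~ i)) odd3.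
have sM2 : w_supercommuting r (iter n2 ( *%R (even_w (~~ i))) \o M).
  by have := supercommuting_comp (supercommuting_iter n2 (sW (~~ i))) sM; rewrite mul1r.
have := diagonal_iter n1 rr (sB i) (sW i) sM2 (B_exp i) (Bw i i) _ _ even2.
rewrite mul1r; apply.
- by move=> f /=; rewrite -(BM _ (sB i)); elim: (n2) => //= n <-; apply: Bw.
- move=> f /=; rewrite Mw; elim: (n2) => //= n ->.
  by case: (i); apply: evenAC.
Qed.

(* Multiplication by a variable preserves the filtration by the variables z and
   a derivative lowers it by one; a Bessel operator is a sum of a derivative and
   of terms with one variable z and two derivatives. *)
Local Notation zfilt := (zfilt [:: Z1; Z2; T3; T4]).

Let zfilt_X i n f : zfilt n f -> zfilt n (X i * f).
Proof.
apply: zfilt_supercommuting => [c g h|z _]; first by rewrite mulrDr scalerAr.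
by exists 1 => g; rewrite scale1r !mulrA XC.
Qed.
Let zfilt_theta j n f : zfilt n f -> zfilt n (theta j * f).
Proof.
apply: zfilt_supercommuting => [c g h|z]; first by rewrite mulrDr scalerAr.
rewrite !inE => /or4P[] /eqP->; (exists 1 => g; rewrite scale1r; exact: odd_even)
  || (by exists (-1) => g; rewrite scaleN1r; exact: odd_anti).
Qed.
Let zfilt_dX i n f : zfilt n f -> zfilt n.-1 (dX i f).
Proof.
apply: zfilt_derivation => [c g h|z]; first exact: linearP.
rewrite !inE => /or4P[] /eqP->;
  [exists (i1 == i)%:R, 1 | exists (i2 == i)%:R, 1 | exists 0, 1 | exists 0, 1] => g;
  by rewrite ?dXX ?dXtheta ?scale0r ?add0r scale1r.
Qed.
Let zfilt_dtheta j n f : zfilt n f -> zfilt n.-1 (dtheta j f).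
Proof.
apply: zfilt_derivation => [c g h|z]; first exact: linearP.
rewrite !inE => /or4P[] /eqP->;
  [exists 0, 1 | exists 0, 1 | exists (j3 == j)%:R, (-1) | exists (j4 == j)%:R, (-1)] => g;
  by rewrite ?dtheta2 ?dthetaX ?scale0r ?add0r ?scale1r ?scaleN1r.
Qed.
Let zfilt_z z n f : z \in [:: Z1; Z2; T3; T4] ->
  zfilt n.-2 f -> zfilt n.-1 (z * f).
Proof.
by case: n => [|[|n]] zZ zf; [apply: zfilt_any | apply: zfilt_any | apply: zfilt_mul].
Qed.

Lemma zfilt_pairing n : zfilt n (x ^+ n).
Proof.
elim: n => [|n IHn]; first exact: zfilt_any.
rewrite exprS; move: (x ^+ n) IHn => y zy.
rewrite /pairing !mulrDl !mulNr -!scalerAl -!mulrA.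
have zZ : [/\ Z1 \in [:: Z1; Z2; T3; T4], Z2 \in [:: Z1; Z2; T3; T4],
  T3 \in [:: Z1; Z2; T3; T4] & T4 \in [:: Z1; Z2; T3; T4]].
  by rewrite !inE !eqxx !orbT.
have [zZ1 zZ2 zT3 zT4] := zZ.
by do !apply: zfiltD; rewrite -?scaleNr; apply: zfiltZ; apply: zfilt_mul => //;
  (exact: zfilt_X || exact: zfilt_theta).
Qed.

Let zfilt_bessel n f : zfilt n f ->
  [/\ zfilt n.-1 (gbessel1 f), zfilt n.-1 (gbessel2 f),
      zfilt n.-1 (gbessel3 f) & zfilt n.-1 (gbessel4 f)].
Proof.
move=> zf.
have zZ : [/\ Z1 \in [:: Z1; Z2; T3; T4], Z2 \in [:: Z1; Z2; T3; T4],
  T3 \in [:: Z1; Z2; T3; T4] & T4 \in [:: Z1; Z2; T3; T4]].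
  by rewrite !inE !eqxx !orbT.
have [zZ1 zZ2 zT3 zT4] := zZ.
by split; do !apply: zfiltD; do ?[apply: zfiltN]; do ?[apply: zfiltZ];
  do ?[apply: zfilt_z => //]; do ?[apply: zfilt_dX]; do ?[apply: zfilt_dtheta];
  do ?[apply: zfilt_dX].
Qed.

Lemma zfilt_bessel_word (i : bool) (n1 n2 : nat) (e3 e4 : bool) (k : nat) :
  zfilt (k - (n1 + (n2 + (e3 + e4)))) (bessel_word i n1 n2 e3 e4 (x ^+ k)).
Proof.
have it L m q l : (forall n f, zfilt n f -> zfilt n.-1 (L f)) -> zfilt (k - l) q ->
    zfilt (k - (m + l)) (iter m L q).
  by move=> zL zq; elim: m => //= m IHm; rewrite addSn subnS; apply: zL.
have zE j n f : zfilt n f -> zfilt n.-1 (even_bessel j f).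
  by move=> /zfilt_bessel[]; case: j.
rewrite /bessel_word; apply: (it _ _ _ _ (zE _)); apply: (it _ _ _ _ (zE _)).
apply: (it) => [n f /zfilt_bessel[]//|].
have := it gbessel4 e4 (x ^+ k) 0%N; rewrite addn0 subn0; apply.
  by move=> n f /zfilt_bessel[].
exact: zfilt_pairing.
Qed.

End GenericBessel.

(** * Conjugation of coefficients and evaluation at z = 0 *)

Section SpMap.
Variables (K : comNzRingType) (m n : nat) (phi : {rmorphism K -> K}).
Implicit Types f g : superpoly K m n.

Lemma sp_mapE f S : sp_map phi f S = map_mpoly phi (f S). Proof. by rewrite ffunE. Qed.
Lemma sp_mapD f g : sp_map phi (f + g) = sp_map phi f + sp_map phi g.
Proof. by apply/ffunP => S; rewrite sp_addE !sp_mapE sp_addE rmorphD. Qed.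
Lemma sp_mapN f : sp_map phi (- f) = - sp_map phi f.
Proof. by apply/ffunP => S; rewrite sp_oppE !sp_mapE sp_oppE rmorphN. Qed.
Lemma sp_mapZ c f : sp_map phi (c *: f) = phi c *: sp_map phi f.
Proof. by apply/ffunP => S; rewrite sp_scaleE !sp_mapE sp_scaleE map_mpolyZ. Qed.
Lemma sp_mapM f g : sp_map phi (f * g) = sp_map phi f * sp_map phi g.
Proof.
apply/ffunP => S; rewrite sp_mapE !sp_mulE rmorph_sum.
apply: eq_bigr => A _; rewrite !sp_mapE !rmorphM rmorphXn rmorphN rmorph1 //.
Qed.
Lemma sp_map1 : sp_map phi (1 : superpoly K m n) = 1.
Proof.
apply/ffunP => S; rewrite sp_mapE !sp_oneE.
by case: (_ == _); rewrite ?rmorph0 ?rmorph1.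
Qed.
Lemma sp_mapXn f k : sp_map phi (f ^+ k) = sp_map phi f ^+ k.
Proof. by elim: k => [|k IHk]; rewrite ?sp_map1 // !exprS sp_mapM IHk. Qed.
Lemma sp_map_even i : sp_map phi (sp_even K n i) = sp_even K n i :> superpoly K m n.
Proof.
apply/ffunP => S; rewrite sp_mapE !ffunE; case: (_ == _); rewrite ?rmorph0 //.
exact: map_mpolyX.
Qed.
Lemma sp_map_odd j : sp_map phi (sp_odd K m j) = sp_odd K m j :> superpoly K m n.
Proof. by apply/ffunP => S; rewrite sp_mapE !ffunE; case: (_ == _); rewrite ?rmorph0 ?rmorph1. Qed.
End SpMap.

Section AtZ0.
Variable R : realType.
Local Notation C := (complex R).
Implicit Types (f : Pzw R) (S : {set 'I_2}).

Lemma at_z0E f S : at_z0 f S = f [set rshift 2 j | j in S] \mPo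
    [tuple (if split i is inr j then 'X_j else 0) | i < 2 + 2].
Proof. by rewrite ffunE. Qed.

Fact at_z0_linear : linear (@at_z0 R).
Proof.
move=> c f g; apply/ffunP => S; apply: (etrans (at_z0E _ _)).
rewrite [(c *: f + g) _]sp_addE [(c *: f) _]sp_scaleE comp_mpolyD comp_mpolyZ.
apply/esym/(etrans (sp_addE _ _ _)); congr (_ + _); last exact: at_z0E.
by apply: (etrans (sp_scaleE _ _ _)); congr (_ *: _); apply: at_z0E.
Qed.
HB.instance Definition _ := GRing.isLinear.Build C (Pzw R) (P22 R) *:%R (@at_z0 R) at_z0_linear.

Lemma at_z0_zeven i f : at_z0 (sp_even C (2 + 2) (lshift 2 i) * f) = 0.
Proof.
apply/ffunP => S; rewrite at_z0E sp_evenM rmorphM /= comp_mpolyXU.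
by rewrite -(tnth_nth 0) tnth_mktuple (unsplitK (inl i)) mul0r sp_0E.
Qed.

Lemma at_z0_weven i f : at_z0 (sp_even C (2 + 2) (rshift 2 i) * f) = sp_even C 2 i * at_z0 f.
Proof.
apply/ffunP => S; apply/esym/(etrans (sp_evenM _ _ _))/esym/(etrans (at_z0E _ _)).
rewrite sp_evenM rmorphM /= comp_mpolyXU -(tnth_nth 0) tnth_mktuple.
by rewrite (unsplitK (inr i)) at_z0E.
Qed.

Lemma at_z0_zodd j f : at_z0 (sp_odd C (2 + 2) (lshift 2 j) * f) = 0.
Proof.
apply/ffunP => S; rewrite at_z0E sp_oddM.
case: ifP => [/imsetP[k _ /eqP]|_]; last by rewrite rmorph0 sp_0E.
by rewrite eq_lrshift.
Qed.

Lemma at_z0_wodd j f : at_z0 (sp_odd C (2 + 2) (rshift 2 j) * f) = sp_odd C 2 j * at_z0 f.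
Proof.
have inj : injective (@rshift 2 2) := @rshift_inj 2 2.
apply/ffunP => S; apply/esym/(etrans (sp_oddM _ _ _))/esym/(etrans (at_z0E _ _)).
rewrite sp_oddM mem_imset //.
case: ifP => jS; last by rewrite rmorph0.
rewrite rmorphM rmorphXn rmorphN rmorph1 at_z0E; congr ((-1) ^+ _ * (f _ \mPo _)).
  rewrite /below -[RHS](card_imset _ inj); apply: eq_card => k; rewrite inE.
  apply/andP/imsetP => [[/imsetP[l lS ->]]|[l]].
    by rewrite /= ltn_add2l => lj; exists l; rewrite // inE lS.
  by rewrite inE => /andP[lS lj] ->; rewrite mem_imset // lS /= ltn_add2l.
apply/setP => k; rewrite !inE; apply/andP/imsetP => [[kj /imsetP[l lS ek]]|[l]].
  by exists l; rewrite // !inE lS andbT; apply: contraNneq kj => <-; rewrite ek.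
by rewrite !inE => /andP[lj lS] ->; rewrite mem_imset // lS (inj_eq inj).
Qed.

Lemma at_z0_1 : at_z0 (1 : Pzw R) = 1.
Proof.
apply/ffunP => S; rewrite at_z0E !sp_oneE imset_eq0.
by case: (_ == _); rewrite ?rmorph0 ?rmorph1.
Qed.
End AtZ0.

(** * Decomposition into monomials *)

Section Monomials.
Variable K : comNzRingType.
Local Notation P := (superpoly K 2 2).
Local Notation x1 := (sp_even K 2 (ord0 : 'I_2)).
Local Notation x2 := (sp_even K 2 (ord_max : 'I_2)).
Local Notation x3 := (sp_odd K 2 (ord0 : 'I_2)).
Local Notation x4 := (sp_odd K 2 (ord_max : 'I_2)).

Definition sp_word (n1 n2 : nat) (e3 e4 : bool) (f : P) : P :=
  iter n1 ( *%R x1) (iter n2 ( *%R x2) (iter e3 ( *%R x3) (iter e4 ( *%R x4) f))).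

Lemma iter_sp_even n (i : 'I_2) (f : P) T :
  iter n ( *%R (sp_even K 2 i)) f T = 'X_i ^+ n * f T.
Proof.
elim: n => [|n IHn]; first by rewrite mul1r.
by rewrite iterS sp_evenM IHn exprS mulrA.
Qed.

(** On two odd variables the sign of theta_1 theta_2 is trivial: nothing lies below
    the first index, and only the first index below the second. *)
Lemma sp_odd_word (S T : {set 'I_2}) :
  iter (ord0 \in S) ( *%R x3) (iter (ord_max \in S) ( *%R x4) 1) T = (T == S)%:R.
Proof.
have ordP (j : 'I_2) : j = ord0 \/ j = ord_max.
  by case: j => [[|[|//]]] lt_j; [left | right]; apply: val_inj.
have eqS (A B : {set 'I_2}) :
    (A == B) = ((ord0 \in A) == (ord0 \in B)) && ((ord_max \in A) == (ord_max \in B)).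
  apply/eqP/andP => [->|[/eqP e0 /eqP e1]]; first by rewrite !eqxx.
  by apply/setP => j; case: (ordP j) => ->.
have below0 A : below (ord0 : 'I_2) A = 0%N.
  by apply: eq_card0 => j; rewrite inE ltn0 andbF.
have below1 (A : {set 'I_2}) : ord0 \notin A -> below (ord_max : 'I_2) A = 0%N.
  move=> /negPf A0; apply: eq_card0 => j; rewrite inE.
  by case: (ordP j) => ->; rewrite ?A0 ?ltnn ?andbF.
have x4E A : (x4 * 1) A = ((ord0 \notin A) && (ord_max \in A))%:R.
  rewrite sp_oddM sp_oneE eqS !inE eqxx /=.
  case: ifP => _; rewrite ?andbF // ?andbT.
  by case A0: (ord0 \in A); rewrite ?mulr0 // below1 ?A0 // mul1r.
rewrite eqS; case S0: (ord0 \in S); case S1: (ord_max \in S) => /=;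
  rewrite ?x4E ?(sp_oddM (ord0 : 'I_2)) ?below0 ?x4E ?sp_oneE ?eqS ?inE ?mul1r;
  by case: (ord0 \in T); case: (ord_max \in T).
Qed.

Lemma sp_wordE n1 n2 (S T : {set 'I_2}) :
  sp_word n1 n2 (ord0 \in S) (ord_max \in S) 1 T =
  'X_ord0 ^+ n1 * ('X_ord_max ^+ n2 * (T == S)%:R).
Proof.
apply: (etrans (iter_sp_even _ _ _ _)); congr (_ * _).
by apply: (etrans (iter_sp_even _ _ _ _)); rewrite sp_odd_word.
Qed.

Lemma sp_monomials (p : P) :
  p = \sum_S \sum_(g <- msupp (p S))
    (p S)@_g *: sp_word (g ord0) (g ord_max) (ord0 \in S) (ord_max \in S) 1.
Proof.
apply/ffunP => T; rewrite sp_sumE.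
rewrite (bigD1 T) //= [X in _ + X]big1 ?addr0 => [|S nTS].
  rewrite sp_sumE {1}(mpolyE (p T)); apply: eq_bigr => g _.
  rewrite sp_scaleE sp_wordE eqxx mulr1 mpolyXE_id big_ord_recl big_ord1.
  by rewrite (_ : lift ord0 ord0 = ord_max) //; apply: val_inj.
rewrite sp_sumE big1 // => g _; rewrite sp_scaleE sp_wordE.
by rewrite eq_sym (negPf nTS) !mulr0 scaler0.
Qed.
End Monomials.

(** * The operators in the variables z and w *)

(** The flag i selects the even index e that plays the role of 1 in the
    two-parameter family; i = false exchanges the two even indices. *)
Section Reproducing.
Variables (R : realType) (a b : complex R) (i : bool).
Hypothesis a0 : a != 0.
Local Notation C := (complex R).
Local Notation e := (if i then ord0 : 'I_2 else ord_max).
Local Notation e' := (if i then ord_max : 'I_2 else ord0).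
Local Notation o1 := (ord0 : 'I_2).
Local Notation o2 := (ord_max : 'I_2).
Local Notation P := (superpoly C (2 + 2) (2 + 2)).

Definition evens (l : 'I_(2 + 2)) : P := sp_even C (2 + 2) l.
Definition odds (l : 'I_(2 + 2)) : P := sp_odd C (2 + 2) l.
Definition d_evens (l : 'I_(2 + 2)) : {linear P -> P} := @d_even C (2 + 2) (2 + 2) l.
Definition d_odds (l : 'I_(2 + 2)) : {linear P -> P} := @d_odd C (2 + 2) (2 + 2) l.

Definition pairing22 : P := pairing evens odds a b (lshift 2 e) (lshift 2 e')
  (rshift 2 e) (rshift 2 e') (lshift 2 o1) (lshift 2 o2) (rshift 2 o1) (rshift 2 o2).
Local Notation x := pairing22.
Definition bessel_word22 := bessel_word evens odds d_evens d_odds a b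
  (lshift 2 e) (lshift 2 e') (lshift 2 o1) (lshift 2 o2) i.
Definition w_word22 := w_word evens odds
  (rshift 2 e) (rshift 2 e') (rshift 2 o1) (rshift 2 o2) i.

Let evensC l f : evens l * f = f * evens l.
Proof. exact: sp_evenC. Qed.
Let oddsN l k : odds l * odds k = - (odds k * odds l).
Proof. exact: sp_odd_anti. Qed.
Let odds2 l : odds l * odds l = 0.
Proof. exact: sp_odd_sqr. Qed.
Let d_evens_even l k f :
  d_evens l (evens k * f) = (k == l)%:R *: f + evens k * d_evens l f.
Proof. exact: d_even_even. Qed.
Let d_evens_odd l k f : d_evens l (odds k * f) = odds k * d_evens l f.
Proof. exact: d_even_odd. Qed.
Let d_odds_even l k f : d_odds l (evens k * f) = evens k * d_odds l f.
Proof. exact: d_odd_even. Qed.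
Let d_odds_odd l k f :
  d_odds l (odds k * f) = (k == l)%:R *: f - odds k * d_odds l f.
Proof. exact: d_odd_odd. Qed.

Lemma bessel_word22_exp (n1 n2 : nat) (e3 e4 : bool) (k : nat) :
  let n := (n1 + (n2 + (e3 + e4)))%N in
  in_relations evens odds a (rshift 2 e) (rshift 2 e') (rshift 2 o1) (rshift 2 o2)
    (bessel_word22 n1 n2 e3 e4 (x ^+ k)
      - falling a b n k *: w_word22 n1 n2 e3 e4 (x ^+ (k - n))).
Proof.
apply: bessel_word_exp => //; try by case: (i).
- exact: d_even1.
- exact: d_odd1.
Qed.

Let uniq_even : uniq [:: lshift 2 e; lshift 2 e'; rshift 2 e; rshift 2 e'].
Proof. by case: (i). Qed.
Let uniq_odd : uniq [:: lshift 2 o1; lshift 2 o2; rshift 2 o1; rshift 2 o2].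
Proof. by []. Qed.

Lemma bessel_word22Z n1 n2 e3 e4 c f :
  bessel_word22 n1 n2 e3 e4 (c *: f) = c *: bessel_word22 n1 n2 e3 e4 f.
Proof.
by apply: linear_scale; apply: (bessel_word_linear _ _ _ _ _ _ _ a0 uniq_even uniq_odd).
Qed.

Lemma zfilt_word22 (n1 n2 : nat) (e3 e4 : bool) (k : nat) :
  zfilt [:: evens (lshift 2 e); evens (lshift 2 e'); odds (lshift 2 o1); odds (lshift 2 o2)]
    (k - (n1 + (n2 + (e3 + e4)))) (bessel_word22 n1 n2 e3 e4 (x ^+ k)).
Proof. by apply: zfilt_bessel_word. Qed.

Lemma zfilt_pairing22 k :
  zfilt [:: evens (lshift 2 e); evens (lshift 2 e'); odds (lshift 2 o1); odds (lshift 2 o2)]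
    k (x ^+ k).
Proof. by apply: zfilt_pairing. Qed.

Lemma at_z0_zfilt k (f : P) :
  zfilt [:: evens (lshift 2 e); evens (lshift 2 e'); odds (lshift 2 o1); odds (lshift 2 o2)]
    k f -> (0 < k)%N -> @at_z0 R f = 0.
Proof.
move=> zf k0; apply: (zfilt_eval _ k0 zf) => z g.
by rewrite !inE => /or4P[] /eqP->;
  [exact: at_z0_zeven | exact: at_z0_zeven | exact: at_z0_zodd | exact: at_z0_zodd].
Qed.

Lemma at_z0_w_word n1 n2 e3 e4 (f : P) :
  @at_z0 R (w_word22 n1 n2 e3 e4 f) = sp_word n1 n2 e3 e4 (@at_z0 R f).
Proof.
rewrite /w_word22 /w_word /sp_word.
have it n (w : P) (y : P22 R) q : (forall q : P, @at_z0 R (w * q) = y * @at_z0 R q) ->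
    @at_z0 R (iter n ( *%R w) q) = iter n ( *%R y) (@at_z0 R q).
  by move=> wy; elim: n => // n IHn; rewrite !iterS wy IHn.
have w1 q : @at_z0 R (even_w evens (rshift 2 e) (rshift 2 e') i * q) =
    sp_even C 2 o1 * @at_z0 R q.
  by case: (i); apply: at_z0_weven.
have w2 q : @at_z0 R (even_w evens (rshift 2 e) (rshift 2 e') (~~ i) * q) =
    sp_even C 2 o2 * @at_z0 R q.
  by case: (i); apply: at_z0_weven.
rewrite (it _ _ _ _ w1) (it _ _ _ _ w2).
rewrite (it _ _ _ _ (at_z0_wodd o1)) (it _ _ _ _ (at_z0_wodd o2)).
by [].
Qed.
End Reproducing.

(** * The reproducing property *)

Section ReproducingKernel.
Variables (R : realType) (alpha lambda : R) (a b : complex R) (i : bool).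
Hypothesis a0 : a != 0.
Local Notation C := (complex R).
Local Notation "c %:C" := (real_complex R c).
Local Notation e := (if i then ord0 : 'I_2 else ord_max).
Local Notation e' := (if i then ord_max : 'I_2 else ord0).
Local Notation o1 := (ord0 : 'I_2).
Local Notation o2 := (ord_max : 'I_2).
Local Notation P := (superpoly C (2 + 2) (2 + 2)).
Local Notation x := (pairing22 a b i).

Definition relations : seq (P22 R) :=
  let xe : P22 R := sp_even C 2 e in let xe' : P22 R := sp_even C 2 e' in
  let x3 : P22 R := sp_odd C 2 o1 in let x4 : P22 R := sp_odd C 2 o2 in
  [:: (2 * a) *: (xe * xe') + x3 * x4; xe' ^+ 2; xe' * x3; xe' * x4].

Lemma ideal_genZ (G : seq (P22 R)) c f : f \in ideal_pred G -> c *: f \in ideal_pred G.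
Proof.
by move=> /asboolP If; apply/asboolP; rewrite -[c *: f]mulr_algl; apply: ideal_genMl.
Qed.

Lemma at_z0Z c (f : P) : @at_z0 R (c *: f) = c *: at_z0 f.
Proof. exact: linearZ. Qed.

Lemma at_z0_in_relations (f : P) :
  in_relations (evens R) (odds R) a (rshift 2 e) (rshift 2 e') (rshift 2 o1) (rshift 2 o2) f ->
  @at_z0 R f \in ideal_pred relations.
Proof.
move=> vf; have [h1 [h2 [h3 [h4]]]] := @in_relations_eval C P _ _ (evens R) (odds R) a
  (rshift 2 e) (rshift 2 e') (rshift 2 o1) (rshift 2 o2) (P22 R) (@at_z0 R)
  (sp_even C 2 e) (sp_even C 2 e') (sp_odd C 2 o1) (sp_odd C 2 o2) f
  (at_z0_weven e) (at_z0_weven e') (at_z0_wodd o1) (at_z0_wodd o2) vf.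
move=> ->; apply/asboolP.
have gen l : (l < 4)%N -> ideal_gen relations relations`_l.
  by move=> lt_l4; apply/ideal_gen_mem/mem_nth.
apply: ideal_genD; first apply: ideal_genD; first apply: ideal_genD;
  apply: ideal_genMr.
- exact: (gen 0%N).
- exact: (gen 1%N).
- exact: (gen 2%N).
- exact: (gen 3%N).
Qed.

Lemma at_z0_pairing k : (0 < k)%N -> @at_z0 R (x ^+ k) = 0.
Proof. exact: at_z0_zfilt (zfilt_pairing22 _ _ _ _). Qed.

(** Only the power whose exponent is the number of operators survives at z = 0. *)
Lemma at_z0_bessel_word n1 n2 (e3 e4 : bool) k n : n = (n1 + (n2 + (e3 + e4)))%N ->
  @at_z0 R (bessel_word22 a b i n1 n2 e3 e4 (x ^+ k))
    - (if k == n then falling a b n n else 0) *: sp_word n1 n2 e3 e4 1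
  \in ideal_pred relations.
Proof.
move=> nE; have := at_z0_in_relations (bessel_word22_exp b i a0 n1 n2 e3 e4 k).
rewrite -nE linearB linearZ /= at_z0_w_word.
set u := sp_word _ _ _ _ (at_z0 _); set v := (if _ then _ else _) *: _.
suff -> : falling a b n k *: u = v by [].
rewrite {}/v; case: (ltngtP k n) => [lt_kn|lt_nk|eq_kn].
- by rewrite (falling_gt a b lt_kn) [LHS]scale0r [RHS]scale0r.
- have -> : u = 0.
    have it m (y : P22 R) : iter m ( *%R y) 0 = 0.
      by elim: m => // m IHm; rewrite iterS IHm mulr0.
    by rewrite /u at_z0_pairing ?subn_gt0 // /sp_word !it.
  by rewrite [LHS]scaler0 [RHS]scale0r.
- by rewrite /u eq_kn subnn expr0 at_z0_1.
Qed.

Hypothesis bessel_even1 : forall q,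
  even_bessel (evens R) (odds R) (@d_evens R) (@d_odds R) a b (lshift 2 e) (lshift 2 e')
    (lshift 2 o1) (lshift 2 o2) i q = bessel1 alpha lambda q.
Hypothesis bessel_even2 : forall q,
  even_bessel (evens R) (odds R) (@d_evens R) (@d_odds R) a b (lshift 2 e) (lshift 2 e')
    (lshift 2 o1) (lshift 2 o2) (~~ i) q = bessel2 alpha lambda q.
Hypothesis bessel_odd3 : forall q,
  gbessel3 (evens R) (odds R) (@d_evens R) (@d_odds R) a b (lshift 2 e) (lshift 2 e')
    (lshift 2 o1) (lshift 2 o2) q = bessel3 alpha lambda q.
Hypothesis bessel_odd4 : forall q,
  gbessel4 (evens R) (odds R) (@d_evens R) (@d_odds R) a b (lshift 2 e) (lshift 2 e')
    (lshift 2 o1) (lshift 2 o2) q = bessel4 alpha lambda q.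

Lemma bessel_substE p q : bessel_subst alpha lambda p q =
  \sum_S \sum_(g <- msupp (p S)) (p S)@_g *:
    bessel_word22 a b i (g o1) (g o2) (o1 \in S) (o2 \in S) q.
Proof.
apply: eq_bigr => S _; apply: eq_bigr => g _; congr (_ *: _).
have eq_it n (L L' : P -> P) f f' : L =1 L' -> f = f' -> iter n L' f' = iter n L f.
  by move=> eqL ->; apply/esym/eq_iter.
rewrite /bessel_word22 /bessel_word.
apply: (eq_it _ _ _ _ _ bessel_even1); apply/esym.
apply: (eq_it _ _ _ _ _ bessel_even2); apply/esym.
apply: (eq_it _ _ _ _ _ bessel_odd3); apply/esym.
exact: (eq_it _ _ _ _ _ bessel_odd4).
Qed.

Variable kappa : nat -> R.
Hypothesis kernelE : forall k, repr_kernel alpha lambda k = (kappa k)%:C *: x ^+ k.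
Hypothesis kappaE : forall n, (kappa n)%:C * falling a b n n = 1.
Hypothesis conj_pairing : sp_map (@Num.conj C) x = x.
Hypothesis gensE : ideal_gens alpha lambda = relations.

Lemma bessel_fischer_kernel p k :
  bessel_fischer alpha lambda p (repr_kernel alpha lambda k) =
  \sum_S \sum_(g <- msupp (p S)) (p S)@_g *:
    ((kappa k)%:C *:
      @at_z0 R (bessel_word22 a b i (g o1) (g o2) (o1 \in S) (o2 \in S) (x ^+ k))).
Proof.
have conj_kappa : (@Num.conj C) (kappa k)%:C = (kappa k)%:C.
  by apply/CrealP; rewrite complex_real.
have conj_kernel : sp_map (@Num.conj C) ((kappa k)%:C *: x ^+ k) = (kappa k)%:C *: x ^+ k.
  apply: (etrans (sp_mapZ _ _ _)); congr (_ *: _); first exact: conj_kappa.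
  by rewrite (sp_mapXn _ x k) conj_pairing.
rewrite /bessel_fischer kernelE conj_kernel.
rewrite bessel_substE linear_sum; apply: eq_bigr => S _.
rewrite linear_sum; apply: eq_bigr => g _.
rewrite bessel_word22Z //.
exact: etrans (at_z0Z _ _) (congr1 _ (at_z0Z _ _)).
Qed.

(** Any kernel whose n-th coefficient inverts the scalar collected by n operators
    reproduces every monomial, hence every polynomial. *)
Lemma reproducing_kernel p : exists2 r,
  bessel_fischer_series alpha lambda p (repr_kernel alpha lambda) r &
  r - p \in ideal_pred (ideal_gens alpha lambda).
Proof.
(* A monomial of p has degree less than msize in the even variables and at most
   2 in the odd ones. *)
pose N := (\max_S msize (p S) + 2)%N.
pose bf k := bessel_fischer alpha lambda p (repr_kernel alpha lambda k).
have deg_lt S g : g \in msupp (p S) -> (g o1 + (g o2 + ((o1 \in S) + (o2 \in S))) < N)%N.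
  move=> /msize_mdeg_lt; rewrite mdegE big_ord_recl big_ord1.
  rewrite (_ : lift ord0 ord0 = o2); last exact: val_inj.
  move=> lt_g; have le_S : (msize (p S) <= \max_S msize (p S))%N by apply: leq_bigmax.
  rewrite addnA /N addn2; apply: leq_ltn_trans (_ : g o1 + g o2 + 2 < _)%N.
    by rewrite leq_add2l; case: (_ \in S); case: (_ \in S).
  by rewrite addn2 2!ltnS (leq_trans lt_g).
have bf0 k : (N <= k)%N -> bf k = 0.
  move=> le_Nk; rewrite /bf bessel_fischer_kernel big1 // => S _.
  rewrite big_seq big1 // => g gS; rewrite (at_z0_zfilt (zfilt_word22 _ _ _ _ _ _ _ _)).
    by rewrite !scaler0.
  by rewrite subn_gt0 (leq_trans (deg_lt _ _ gS)).
exists (\sum_(k < N) bf k).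
  exists N => n /subnKC <-; elim: (n - N)%N => [|d IHd]; first by rewrite addn0.
  by rewrite addnS big_ord_recr IHd /= -/(bf _) bf0 ?leq_addr ?addr0.
pose w (S : {set 'I_2}) (g : 'X_{1..2}) :=
  sp_word (g o1) (g o2) (o1 \in S) (o2 \in S) (1 : P22 R).
pose v (S : {set 'I_2}) (g : 'X_{1..2}) k :=
  at_z0 (bessel_word22 a b i (g o1) (g o2) (o1 \in S) (o2 \in S) (x ^+ k)).
have sumE : \sum_(k < N) bf k = \sum_S \sum_(g <- msupp (p S))
    (p S)@_g *: \sum_(k < N) (kappa k)%:C *: v S g k.
  transitivity (\sum_(k < N) \sum_S \sum_(g <- msupp (p S))
      (p S)@_g *: ((kappa k)%:C *: v S g k)).
    by apply: eq_bigr => k _; apply: bessel_fischer_kernel.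
  rewrite exchange_big; apply: eq_bigr => S _; rewrite exchange_big.
  by apply: eq_bigr => g _; rewrite scaler_sumr.
rewrite gensE sumE [X in _ - X](sp_monomials p) -sumrB; apply: rpred_sum => S _.
rewrite -sumrB big_seq; apply: rpred_sum => g gS.
rewrite -scalerBr; apply: ideal_genZ; rewrite -/(w S g).
set n := (g o1 + (g o2 + ((o1 \in S) + (o2 \in S))))%N.
have nN : (n < N)%N := deg_lt _ _ gS.
have -> : w S g = \sum_(k < N) (kappa k)%:C *:
    ((if k == n :> nat then falling a b n n else 0) *: w S g).
  rewrite (bigD1 (Ordinal nN)) //= eqxx scalerA kappaE scale1r big1 ?addr0 //.
  by move=> k; rewrite -val_eqE /= => /negPf ->; rewrite scale0r scaler0.
rewrite -sumrB; apply: rpred_sum => k _; rewrite -scalerBr; apply: ideal_genZ.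
exact: at_z0_bessel_word.
Qed.
End ReproducingKernel.

Section TwoCases.
Variables (R : realType) (alpha : R).
Hypothesis alpha0 : alpha != 0.
Local Notation C := (complex R).
Local Notation "c %:C" := (real_complex R c).
Local Notation o1 := (ord0 : 'I_2).
Local Notation o2 := (ord_max : 'I_2).

Lemma conj_pairing22 (a b : R) i :
  sp_map (@Num.conj C) (pairing22 a%:C b%:C i) = pairing22 a%:C b%:C i.
Proof.
have conjR r : (@Num.conj C) r%:C = r%:C by apply/CrealP; rewrite complex_real.
have conj2 : (@Num.conj C) 2^-1 = 2^-1.
  by rewrite -[2^-1](_ : (2^-1)%:C = _) // fmorphV rmorph_nat.
have mapE c (f g : Pzw R) : (@Num.conj C) c = c -> sp_map (@Num.conj C) f = f ->
    sp_map (@Num.conj C) g = g -> sp_map (@Num.conj C) (c *: (f * g)) = c *: (f * g).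
  move=> ec ef eg; apply: (etrans (sp_mapZ _ _ _)).
  by apply: (congr2 *:%R ec); apply: (etrans (sp_mapM _ _ _)); apply: congr2.
apply: (etrans (sp_mapD _ _ _)); congr (_ + _); last first.
  by apply: mapE conj2 _ _; apply: sp_map_odd.
apply: (etrans (sp_mapD _ _ _)); congr (_ + _); last first.
  apply: (etrans (sp_mapN _ _)); congr (- _).
  by apply: mapE conj2 _ _; apply: sp_map_odd.
apply: (etrans (sp_mapD _ _ _)); congr (_ + _).
  by apply: mapE (conjR a) _ _; apply: sp_map_even.
by apply: mapE (conjR b) _ _; apply: sp_map_even.
Qed.

Let oneC : 1%:C = 1 :> C. Proof. exact: rmorph1. Qed.
Let two1 : 2 * 1 = 2 :> C. Proof. exact: mulr1. Qed.
Let twoC r : (2 * r)%:C = 2 * r%:C.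
Proof. by rewrite rmorphM rmorph_nat. Qed.

Lemma falling_diag_real (a b : R) n :
  falling a%:C b%:C n n = (n`!%:R * \prod_(j < n) (j%:R * a - b))%:C.
Proof.
rewrite falling_diag rmorphM rmorph_nat rmorph_prod; congr (_ * _).
by apply: eq_bigr => j _; rewrite rmorphB rmorphM rmorph_nat.
Qed.

(** The argument of Gamma is left in the shape in which the index -1 + s of the
    Bessel function produces it. *)
Lemma Gamma_ratio (s : R) n : GammaLimit.nonpole s ->
  Gamma s * (n`!%:R * Gamma (n%:R + (- 1 + s) + 1))^-1
    * (n`!%:R * \prod_(j < n) (j%:R + s)) = 1.
Proof.
move=> s0; have -> : n%:R + (- 1 + s) + 1 = n%:R + s by ring.
rewrite (GammaLimit.GammaD_nat n s0).
have G0 := GammaLimit.Gamma_neq0 s0.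
have p0 : \prod_(j < n) (s + j%:R) != 0.
  by apply/prodf_neq0 => j _; apply: s0.
have f0 : n`!%:R != 0 :> R by rewrite pnatr_eq0 -lt0n fact_gt0.
have -> : \prod_(j < n) (j%:R + s) = \prod_(j < n) (s + j%:R).
  by apply: eq_bigr => j _; rewrite addrC.
by field; rewrite f0 p0 G0.
Qed.

Lemma nonpole_opp (s : R) : s \isn't a Num.nat -> GammaLimit.nonpole (- s).
Proof.
move=> sN j; apply: contraNneq sN => /eqP; rewrite addrC subr_eq0 => /eqP <-.
exact: natr_nat.
Qed.

Lemma reproducing_alpha (p : P22 R) : alpha \isn't a Num.nat -> exists2 r,
  bessel_fischer_series alpha alpha p (repr_kernel alpha alpha) r &
  r - p \in ideal_pred (ideal_gens alpha alpha).
Proof.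
move=> aN; have s0 := nonpole_opp aN.
pose kappa n := Gamma (- alpha) * (n`!%:R * Gamma (n%:R + (- 1 - alpha) + 1))^-1.
apply: (@reproducing_kernel R alpha alpha 1%:C alpha%:C true _ _ _ _ _ kappa).
- by rewrite oneC oner_neq0.
- have b1 : alpha%:C / 1 = alpha%:C by exact: divr1.
  move=> q; rewrite /bessel1 twoC /even_bessel /gbessel1 oneC b1; reflexivity.
- have c1 : alpha / alpha = 1 by exact: divff.
  move=> q; rewrite /bessel2 c1 /even_bessel /gbessel2 oneC two1; reflexivity.
- have one_alpha : (2 * (1 + alpha))%:C = 2 * (1 + alpha%:C) by rewrite twoC rmorphD /= oneC.
  move=> q; rewrite /bessel3 one_alpha !twoC /gbessel3 oneC two1; reflexivity.
- have one_alpha : (2 * (1 + alpha))%:C = 2 * (1 + alpha%:C) by rewrite twoC rmorphD /= oneC.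
  move=> q; rewrite /bessel4 one_alpha !twoC /gbessel4 oneC two1; reflexivity.
- move=> k; rewrite /repr_kernel eqxx /bessel_I scalerA -rmorphM.
  have -> : zw_pairing alpha = pairing22 1%:C alpha%:C true.
    rewrite /pairing22 /pairing oneC scale1r. reflexivity.
  reflexivity.
- move=> n; rewrite falling_diag_real -rmorphM (_ : _ * _ = 1) ?oneC //.
  apply: (etrans _ (Gamma_ratio n s0)); congr (_ * (_ * _)).
  by apply: eq_bigr => j _; rewrite mulr1.
- exact: conj_pairing22.
- by rewrite /ideal_gens eqxx /relations oneC mulr1.
Qed.

Lemma reproducing_one (p : P22 R) : alpha != 1 -> alpha^-1 \isn't a Num.nat -> exists2 r,
  bessel_fischer_series alpha 1 p (repr_kernel alpha 1) r &
  r - p \in ideal_pred (ideal_gens alpha 1).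
Proof.
move=> alpha1 aN; have s0 := nonpole_opp aN.
(* The powers of alpha^-1 come from rescaling the pairing in the argument of the
   Bessel function. *)
pose kappa n := Gamma (- alpha^-1) * (n`!%:R * Gamma (n%:R + (- 1 - alpha^-1) + 1))^-1
  * (alpha^-1) ^+ n.
apply: (@reproducing_kernel R alpha 1 alpha%:C 1%:C false _ _ _ _ _ kappa).
- by rewrite fmorph_eq0.
- move=> q; rewrite /bessel1 twoC /even_bessel /gbessel2 oneC; reflexivity.
- have inv_alpha : (1 / alpha)%:C = 1 / alpha%:C by rewrite fmorph_div /= oneC.
  move=> q; rewrite /bessel2 inv_alpha /even_bessel /gbessel1 oneC two1; reflexivity.
- have one_alpha : (2 * (1 + alpha))%:C = 2 * (alpha%:C + 1).
    by rewrite twoC rmorphD /= oneC addrC.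
  move=> q; rewrite /bessel3 one_alpha !twoC /gbessel3 oneC two1.
  have dC : d1 (d2 q) = d2 (d1 q) by exact: d_evenC.
  rewrite dC [X in X + _ + _ = _]addrAC; reflexivity.
- have one_alpha : (2 * (1 + alpha))%:C = 2 * (alpha%:C + 1).
    by rewrite twoC rmorphD /= oneC addrC.
  move=> q; rewrite /bessel4 one_alpha !twoC /gbessel4 oneC two1.
  have dC : d1 (d2 q) = d2 (d1 q) by exact: d_evenC.
  rewrite dC [X in X - _ + _ = _]addrAC; reflexivity.
- have zwE : zw_pairing alpha = pairing22 alpha%:C 1%:C false.
    rewrite /pairing22 /pairing oneC scale1r [X in _ = X - _ + _]addrC; reflexivity.
  have if1 (T : Type) (u v : T) : (if 1 == alpha then u else v) = v.
    by rewrite eq_sym (negPf alpha1).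
  move=> k; rewrite /repr_kernel if1 /bessel_I zwE exprZn scalerA -rmorphXn.
  rewrite scalerA -!rmorphM. reflexivity.
- move=> n; rewrite falling_diag_real -rmorphM (_ : _ * _ = 1) ?oneC //.
  have prodE : \prod_(j < n) (j%:R + - alpha^-1) =
      alpha^-1 ^+ n * \prod_(j < n) (j%:R * alpha - 1).
    have -> : alpha^-1 ^+ n = \prod_(j < n) alpha^-1 by rewrite prodr_const card_ord.
    by rewrite -big_split; apply: eq_bigr => j _ /=; field.
  by apply: (etrans _ (Gamma_ratio n s0)); rewrite /kappa prodE; ring.
- exact: conj_pairing22.
- rewrite /ideal_gens eq_sym (negPf alpha1) eqxx /relations twoC.
  by rewrite [in RHS]sp_evenC.
Qed.
End TwoCases.

Local Open Scope quotient_scope.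

Theorem theorem5p10 (R : realType) (alpha lambda : R) :
  alpha != 0 -> alpha != 1 ->
  (lambda = alpha /\ alpha \isn't a Num.nat) \/
  (lambda = 1 /\ alpha^-1 \isn't a Num.nat) ->
  forall (f : fock alpha lambda) (p : P22 R),
    \pi_(fock alpha lambda) p = f ->
  exists2 r : P22 R,
    bessel_fischer_series alpha lambda p (repr_kernel alpha lambda) r
    & \pi_(fock alpha lambda) r = f.
Proof.
move=> alpha0 alpha1 cases f p <-.
have [r rp rI] : exists2 r, bessel_fischer_series alpha lambda p (repr_kernel alpha lambda) r
    & r - p \in ideal_pred (ideal_gens alpha lambda).
  case: cases => -[-> aN]; [exact: reproducing_alpha | exact: reproducing_one].
exists r => //; apply/eqP.
by rewrite -Quotient.idealrBE.
Qed.
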